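(* Let $D$ denote the open unit disk in $\mathbb{R}^2$, and let $A=S_1\cup\dots\cup S_k\subset\mathbb{R}^3$ be any finite configuration of spheres of radius $1$, each passing through the origin of $\mathbb{R}^3$. Then there exist a sequence of smooth maps $\tilde g_n:\partial D=S^1\to\mathbb{R}^3$ and a sequence of functions $u_n:D\to\mathbb{R}^3$ solving $$\begin{cases}\Delta u_n=2\,(u_n)_x\wedge(u_n)_y & \text{in } D,\\ u_n=\tilde g_n & \text{on }\partial D,\end{cases}$$ such that the images $u_n(D)$ converge to $A$ in the Hausdorff sense as $n\to\infty$.
   Context: Subscripts $x,y$ denote partial derivatives with respect to the coordinates of $\mathbb{R}^2$, $\wedge$ is the cross product in $\mathbb{R}^3$, and $\Delta$ acts componentwise. *)

(* Defs.v *)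
From HB Require Import structures.
From mathcomp Require Import all_boot all_order all_algebra.
From mathcomp Require Import all_classical all_reals all_analysis.

Set Implicit Arguments.
Unset Strict Implicit.
Unset Printing Implicit Defensive.
Import Order.TTheory GRing.Theory Num.Theory.
Import numFieldNormedType.Exports.
Local Open Scope classical_set_scope.
Local Open Scope ring_scope.

(* The library norm `|v| on 'rV[R]_n is the max norm; lengths, balls, spheres
   and the Hausdorff distance below are Euclidean. *)
Definition enorm (R : realType) (n : nat) (v : 'rV[R]_n) : R :=
  Num.sqrt (\sum_(i < n) v 0 i ^+ 2).

Definition eball (R : realType) (n : nat) (c : 'rV[R]_n) (r : R) : set 'rV[R]_n :=
  [set x | enorm (x - c) < r].

Definition eclosed_ball (R : realType) (n : nat) (c : 'rV[R]_n) (r : R) :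
    set 'rV[R]_n :=
  [set x | enorm (x - c) <= r].

Definition esphere (R : realType) (n : nat) (c : 'rV[R]_n) (r : R) :
    set 'rV[R]_n :=
  [set x | enorm (x - c) = r].

(* Index arithmetic is in 'I_3, i.e. modulo 3. *)
Definition crossmul (R : realType) (v w : 'rV[R]_3) : 'rV[R]_3 :=
  \row_(i < 3) (v 0 (i + 1) * w 0 (i + 2%:R) - v 0 (i + 2%:R) * w 0 (i + 1)).

Definition partial (R : realType) (m : nat) (W : normedModType R)
    (i : 'I_m.+1) (f : 'rV[R]_m.+1 -> W) : 'rV[R]_m.+1 -> W :=
  'D_(delta_mx 0 i) f.

Definition laplacian (R : realType) (m : nat) (W : normedModType R)
    (f : 'rV[R]_m.+1 -> W) (z : 'rV[R]_m.+1) : W :=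
  \sum_(i < m.+1) partial i (partial i f) z.

(* Meant for U open, where only the values of f on U matter. *)
Fixpoint class_C (R : realType) (m : nat) (W : normedModType R) (k : nat)
    (U : set 'rV[R]_m.+1) (f : 'rV[R]_m.+1 -> W) : Prop :=
  (forall z, U z -> {for z, continuous f}) /\
  match k with
  | 0 => True
  | k'.+1 => forall i : 'I_m.+1,
      (forall z, U z -> derivable f z (delta_mx 0 i)) /\
      class_C k' U (partial i f)
  end.

Definition unit_disk (R : realType) : set 'rV[R]_2 := eball 0 1.

Definition circle_point (R : realType) (t : R) : 'rV[R]_2 :=
  \row_(i < 2) (if i == 0 then cos t else sin t).

(* Smoothness of a map on the manifold S^1, read in the angular coordinate;
   the values of g off the unit circle are irrelevant. *)
Definition smooth_on_circle (R : realType) (W : normedModType R)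
    (g : 'rV[R]_2 -> W) : Prop :=
  forall (m : nat) (t : R),
    derivable (derive1n m (fun s : R => g (circle_point s))) t 1.

(* Classical solutions, in C^2(D) and continuous up to the boundary; the values
   of u outside the closed disk are irrelevant. *)
Definition solves_Hsystem (R : realType) (g u : 'rV[R]_2 -> 'rV[R]_3) : Prop :=
  [/\ class_C 2 (@unit_disk R) u,
      {within eclosed_ball 0 1, continuous u},
      forall z, unit_disk z ->
        laplacian u z = 2%:R *: crossmul (partial 0 u z) (partial 1 u z) &
      forall z, esphere 0 1 z -> u z = g z].

Definition edist_to (R : realType) (n : nat) (A : set 'rV[R]_n) (x : 'rV[R]_n) :
    \bar R :=
  ereal_inf [set (enorm (x - a))%:E | a in A].

Definition hausdorff_dist (R : realType) (n : nat) (A B : set 'rV[R]_n) : \bar R :=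
  Order.max (ereal_sup [set edist_to B x | x in A])
            (ereal_sup [set edist_to A x | x in B]).

(* Main.v *)
(** The boundary data are free, so it suffices to solve the system on a thin
    neighbourhood of a line and to pull it back by a holomorphic map, under which
    [Delta u = 2 u_x /\ u_y] is invariant.

    On a unit sphere through 0, every point [a] lies on a circle
    [(a + t q) / (1 + t^2)], which leaves the origin and comes back to it as [t]
    runs over the line.  Adding up such circles, centred at points far apart, for a
    finite net of points of [A] gives a curve [gamma] which stays close to [A] and
    passes close to each of its points.  The Cauchy problem [u (x, 0) = gamma x],
    [u_y (x, 0) = 0] is solved by a power series [sum_n c_n(x) y^n]: the [c_n] are
    polynomials in the functions [1 / (1 + (x - b)^2)] and
    [(x - b) / (1 + (x - b)^2)], and differentiating a polynomial of degree [d]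
    in them costs a factor [2 d] on its l^1 norm, which the denominator
    [(n + 1) (n + 2)] of the recursion absorbs.  Hence [u] exists on a strip
    [|y| <= eta] and stays close to [gamma] there if [eta] is small.  Finally
    [- h log (1 - r z)] maps the closed disk into this strip when [h] is small, and
    covers the part of the real axis that matters when [r] is close to 1. *)

Require Import Defs.
From HB Require Import structures.
From mathcomp Require Import all_boot all_order all_algebra.
From mathcomp Require Import all_classical all_reals all_analysis.
From mathcomp Require Import ring lra zify.

Set Implicit Arguments.
Unset Strict Implicit.
Unset Printing Implicit Defensive.
Import Order.TTheory GRing.Theory Num.Theory.
Import numFieldNormedType.Exports.
Local Open Scope classical_set_scope.
Local Open Scope ring_scope.

(** * Differentiation rules for real-valued functions on a normed space *)

Section ScalarDerivatives.
Context {R : realType} {V : normedModType R}.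
Implicit Types (f g : V -> R) (x v : V) (a b r : R).

(* These restate the library rules with the derivative typed in [R] itself
   rather than in its regular module, so that [ring] and [field] recognise it. *)
Lemma is_derive_add f g x v a b : is_derive x v f a -> is_derive x v g b ->
  is_derive x v (fun y => f y + g y) (a + b).
Proof. exact: is_deriveD. Qed.

Lemma is_derive_mul f g x v a b : is_derive x v f a -> is_derive x v g b ->
  is_derive x v (fun y => f y * g y) (f x * b + a * g x).
Proof. by move=> df dg; rewrite [a * _]mulrC; exact: is_deriveM. Qed.

Lemma is_derive_scale f x v a r : is_derive x v f a ->
  is_derive x v (fun y => r * f y) (r * a).
Proof. exact: is_deriveZ. Qed.

Lemma is_derive_inv f x v a : f x != 0 -> is_derive x v f a ->
  is_derive x v (fun y => (f y)^-1) (- a / f x ^+ 2).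
Proof.
move=> fx0 [fx <-]; apply: DeriveDef; first exact: derivableV.
by rewrite deriveV// /GRing.scale /= mulNr mulrC mulNr.
Qed.

Lemma is_derive_const r x v : is_derive x v (fun=> r : R) 0.
Proof. exact: is_derive_cst. Qed.

Lemma is_derive_coef f x v a b : is_derive x v f a -> a = b ->
  is_derive x v f b.
Proof. by move=> + <-. Qed.

End ScalarDerivatives.

(** * Polynomials in shifted [1 / (1 + t^2)] and [t / (1 + t^2)], with degree and norm bounds *)

Section MajorizedFunctions.
Context {R : realType}.
Implicit Types (f g : R -> R) (d e n : nat) (M N : R).

(* [d] bounds the degree and [M] the sum of the absolute values of the coefficients
   of some polynomial expression for [f]. *)
Inductive adm : nat -> R -> (R -> R) -> Prop :=
| adm_cst (a : R) : adm 0 `|a| (fun=> a)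
| adm_even (b : R) : adm 1 1 (fun x => (1 + (x - b) ^+ 2)^-1)
| adm_odd (b : R) : adm 1 1 (fun x => (x - b) * (1 + (x - b) ^+ 2)^-1)
| adm_add d M N f g :
    adm d M f -> adm d N g -> adm d (M + N) (fun x => f x + g x)
| adm_mul d e M N f g :
    adm d M f -> adm e N g -> adm (d + e) (M * N) (fun x => f x * g x)
| adm_weaken d e M N f : (d <= e)%N -> M <= N -> adm d M f -> adm e N f.

Lemma sqr_shift_gt0 (x b : R) : 0 < 1 + (x - b) ^+ 2.
Proof. by rewrite ltr_pwDl ?sqr_ge0. Qed.

Lemma adm_ge0 d M f : adm d M f -> 0 <= M.
Proof.
elim=> // {d M f} [d M N f g _ M0 _ N0|d e M N f g _ M0 _ N0|d e M N f _ MN _ M0].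
- exact: addr_ge0.
- exact: mulr_ge0.
- exact: le_trans MN.
Qed.

Lemma adm_bound d M f : adm d M f -> forall x, `|f x| <= M.
Proof.
elim=> // {d M f}.
- move=> b x; have := sqr_shift_gt0 x b => q0.
  have i0 : 0 <= (1 + (x - b) ^+ 2)^-1 by rewrite invr_ge0 ltW.
  by rewrite ger0_norm// invf_le1// lerDl sqr_ge0.
- move=> b x; have := sqr_shift_gt0 x b => q0.
  have i0 : 0 <= (1 + (x - b) ^+ 2)^-1 by rewrite invr_ge0 ltW.
  rewrite normrM [X in _ * X]ger0_norm// ler_pdivrMr// mul1r.
  rewrite -(real_normK (num_real (x - b))).
  by have := sqr_ge0 (`|x - b| - 1 / 2); rewrite !expr2; nra.
- move=> d M N f g _ fM _ gN x.
  by rewrite (le_trans (ler_normD _ _))// lerD.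
- by move=> d e M N f g _ fM _ gN x; rewrite normrM ler_pM.
- by move=> d e M N f _ MN _ fM x; exact: le_trans MN.
Qed.

Lemma adm_scale d M f a : adm d M f -> adm d (`|a| * M) (fun x => a * f x).
Proof. by move=> fM; have := adm_mul (adm_cst a) fM. Qed.

Lemma adm_ext d M f g : f =1 g -> adm d M f -> adm d M g.
Proof. by move=> /funext ->. Qed.

Lemma adm_sum (I : Type) (r : seq I) d (M : I -> R) (f : I -> R -> R) :
  (forall i, adm d (M i) (f i)) ->
  adm d (\sum_(i <- r) M i) (fun x => \sum_(i <- r) f i x).
Proof.
move=> fM; elim: r => [|i r IH].
  apply: (adm_ext (f := fun=> 0)) => [x|]; first by rewrite big_nil.
  by apply: (adm_weaken _ _ (adm_cst 0)) => //; rewrite big_nil normr0.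
apply: (adm_ext (f := fun x => f i x + \sum_(j <- r) f j x)) => [x|].
  by rewrite big_cons.
by rewrite big_cons; exact: adm_add.
Qed.

Lemma is_derive_shift1 (b x : R) : is_derive x 1 (fun y : R => y - b) 1.
Proof. by apply: is_derive_eq; rewrite subr0. Qed.

Lemma is_derive_sqr_shift (b x : R) :
  is_derive x 1 (fun y : R => 1 + (y - b) ^+ 2) (2 * (x - b)).
Proof.
have D := is_derive_shift1 b x; under eq_fun do rewrite expr2.
apply: is_derive_coef (is_derive_add (is_derive_const 1 x 1)
  (is_derive_mul D D)) _.
by ring.
Qed.

Lemma is_derive_inv_sqr_shift (b x : R) :
  is_derive x 1 (fun y : R => (1 + (y - b) ^+ 2)^-1)
    (- (2 * (x - b)) / (1 + (x - b) ^+ 2) ^+ 2).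
Proof.
apply: (is_derive_inv (f := fun y => 1 + (y - b) ^+ 2)) => /=.
  exact: lt0r_neq0 (sqr_shift_gt0 x b).
exact: is_derive_sqr_shift.
Qed.

(** With [p = 1 / (1 + t^2)] and [q = t / (1 + t^2)] one has [p' = - 2 p q] and [q' = p^2 - q^2]:
    degree 2 and norm 2 in both cases. The product rule then adds up one factor 2 per degree. *)
Lemma adm_is_derive d M f : adm d M f ->
  exists2 f', adm d.+1 (2 * d%:R * M) f' & forall x : R, is_derive x 1 f (f' x).
Proof.
elim=> {d M f}.
- move=> a; exists (fun=> 0); last by move=> x; exact: is_derive_cst.
  by apply: (adm_weaken _ _ (adm_cst 0)) => //; rewrite normr0 mulr0 mul0r.
- move=> b.
  exists (fun x => - 2 * ((1 + (x - b) ^+ 2)^-1 * ((x - b) * (1 + (x - b) ^+ 2)^-1))).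
    apply: (adm_weaken _ _ (adm_scale (- 2) (adm_mul (adm_even b) (adm_odd b)))) => //.
    by rewrite normrN ger0_norm// !mulr1.
  move=> x; have q0 := lt0r_neq0 (sqr_shift_gt0 x b).
  by apply: is_derive_coef (is_derive_inv_sqr_shift b x) _; field.
- move=> b.
  exists (fun x => (1 + (x - b) ^+ 2)^-1 * (1 + (x - b) ^+ 2)^-1 +
     -1 * ((x - b) * (1 + (x - b) ^+ 2)^-1 * ((x - b) * (1 + (x - b) ^+ 2)^-1))).
    apply: (adm_weaken _ _ (adm_add (adm_mul (adm_even b) (adm_even b))
      (adm_scale (- 1) (adm_mul (adm_odd b) (adm_odd b))))) => //.
    by rewrite normrN normr1 !mulr1.
  move=> x; have q0 := lt0r_neq0 (sqr_shift_gt0 x b).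
  apply: is_derive_coef (is_derive_mul (is_derive_shift1 b x)
    (is_derive_inv_sqr_shift b x)) _.
  by field.
- move=> d M N f g _ [f' af df] _ [g' ag dg].
  exists (fun x => f' x + g' x); last by move=> x; exact: is_deriveD.
  by apply: (adm_weaken _ _ (adm_add af ag)) => //; rewrite mulrDr.
- move=> d e M N f g aM [f' af df] aN [g' ag dg].
  exists (fun x => f x * g' x + f' x * g x).
    have := adm_mul aM ag; rewrite addnS => A1.
    have := adm_mul af aN; rewrite addSn => A2.
    apply: (adm_weaken _ _ (adm_add A1 A2)) => //.
    by rewrite [leLHS](_ : _ = 2 * (d + e)%:R * (M * N))// natrD; ring.
  by move=> x; exact: is_derive_mul.
- move=> d e M N f de MN aM [f' af df]; exists f' => //.
  apply: (adm_weaken _ _ af) => //; apply: ler_pM => //.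
  + exact: adm_ge0 aM.
  + by rewrite ler_pM// ler_nat.
Qed.

Lemma adm_derivable d M f (x : R) : adm d M f -> derivable f x 1.
Proof. by move=> /adm_is_derive[f' _ /(_ x)[]]. Qed.

Lemma adm_derive1 d M f : adm d M f -> adm d.+1 (2 * d%:R * M) (derive1 f).
Proof.
move=> /adm_is_derive[f' af df]; apply: adm_ext af => x.
by rewrite derive1E (@derive_val _ _ _ _ _ _ _ (df x)).
Qed.

Lemma lipschitz_derive1 f L : (forall x : R, derivable f x 1) ->
  (forall x, `|(derive1 f) x| <= L) -> forall x y, `|f x - f y| <= L * `|x - y|.
Proof.
move=> df fL x y; wlog: x y / y <= x => [H|yx].
  by have [|/ltW] := leP y x => /H//; rewrite distrC [`|y - x|]distrC.
have [|t|c _ ->] := @MVT_segment R f (derive1 f) y x yx.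
- by move=> t _; rewrite derive1E; exact: derivableP.
- apply: derivable_within_continuous => //.
- by rewrite normrM ler_wpM2r.
Qed.

Lemma adm_lipschitz d M f : adm d M f ->
  forall x y, `|f x - f y| <= (2 * d%:R * M) * `|x - y|.
Proof.
move=> fM; apply: lipschitz_derive1 => x; first exact: adm_derivable fM.
exact: adm_bound (adm_derive1 fM) _.
Qed.

End MajorizedFunctions.

(** * Coefficient sequences of geometric growth *)

Section GoodSequences.
Context {R : realType}.
Implicit Types (c : nat -> R -> R) (rho s x y : R).

(* Allowing every rate [s > rho] makes this stable under termwise differentiation,
   which costs a factor linear in [n]. *)
Definition good rho c := exists d, forall s, rho < s ->
  exists C : R, forall n, adm (2 * n + d) (C * s ^+ n) (c n).

Definition coef_dx c : nat -> R -> R := fun n => derive1 (c n).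
Definition coef_dy c : nat -> R -> R := fun n x => n.+1%:R * c n.+1 x.

(** Bernoulli's inequality for [q = b / a] gives [n * (q - 1) <= q ^+ n], so a slightly larger rate
    absorbs a linear factor. *)
Lemma linear_le_geometric (a b : R) d : 0 < a -> a < b ->
  exists2 C : R, 0 <= C & forall n, (2 * n + d)%:R * a ^+ n <= C * b ^+ n.
Proof.
move=> a0 ab; have b0 := lt_trans a0 ab; set q := b / a.
have q1 : 1 < q by rewrite ltr_pdivlMr// mul1r.
have bern n : 1 + n%:R * (q - 1) <= q ^+ n.
  elim: n => [|n IH]; first by rewrite mul0r addr0 expr0.
  rewrite exprS; apply: (@le_trans _ _ (q * (1 + n%:R * (q - 1)))).
    rewrite -natr1; have : 0 <= n%:R * (q - 1) * (q - 1) by rewrite !mulr_ge0// subr_ge0 ltW.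
    by move=> H; rewrite -subr_ge0; apply: le_trans H _; rewrite le_eqVlt; apply/orP; left; apply/eqP; ring.
  by rewrite ler_pM2l// (lt_trans ltr01).
exists (2 / (q - 1) + d%:R) => [|n].
  by rewrite addr_ge0// divr_ge0// subr_ge0 ltW.
have bE : b ^+ n = q ^+ n * a ^+ n by rewrite -exprMn /q divfK// gt_eqF.
rewrite bE mulrA ler_pM2r ?exprn_gt0// natrD natrM [leRHS]mulrDl; apply: lerD.
  rewrite -mulrA ler_pM2l// ler_pdivlMl ?subr_gt0// mulrC.
  by apply: le_trans (bern n); rewrite lerDr.
by rewrite ler_peMr// exprn_ege1// ltW.
Qed.

(** The coefficients are bounded at a rate [u] between [rho] and [s]; the gap between [u] and [s]
    absorbs the degree factor of [adm_derive1]. *)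
Lemma good_coef_dx rho c : 0 < rho -> good rho c -> good rho (coef_dx c).
Proof.
move=> r0 [d gc]; exists d.+1 => s rs.
have [u /andP[ru us]] : exists u, rho < u < s.
  by exists ((rho + s) / 2); rewrite !midf_lt.
have [C adC] := gc _ ru.
have [K K0 HK] := linear_le_geometric d (lt_trans r0 ru) us.
exists (2 * C * K) => n; rewrite addnS.
apply: (adm_weaken _ _ (adm_derive1 (adC n))) => //.
have C0 : 0 <= C.
  have := adm_ge0 (adC 0); by rewrite expr0 mulr1.
rewrite [leLHS](_ : _ = (2 * C) * ((2 * n + d)%:R * u ^+ n)); last by ring.
by rewrite -[leRHS]mulrA ler_wpM2l// mulr_ge0.
Qed.

Lemma good_coef_dy rho c : 0 < rho -> good rho c -> good rho (coef_dy c).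
Proof.
(* The shift from [n] to [n.+1] raises the degree bound by 2. *)
move=> r0 [d gc]; exists (2 + d)%N => s rs.
have [u /andP[ru us]] : exists u, rho < u < s.
  by exists ((rho + s) / 2); rewrite !midf_lt.
have u0 := lt_trans r0 ru.
have [C adC] := gc _ ru.
have [K K0 HK] := linear_le_geometric 1 u0 us.
have C0 : 0 <= C.
  have := adm_ge0 (adC 0); by rewrite expr0 mulr1.
have Cu0 : 0 <= C * u by rewrite mulr_ge0// ltW.
exists (C * u * K) => n.
have := adm_scale n.+1%:R (adC n.+1).
rewrite (_ : 2 * n.+1 + d = 2 * n + (2 + d))%N; last by rewrite mulnS addnA [(2 + _)%N]addnC.
apply: adm_weaken => //; rewrite ger0_norm//.
apply: (@le_trans _ _ (C * u * ((2 * n + 1)%:R * u ^+ n))).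
  rewrite [leLHS](_ : _ = C * u * (n.+1%:R * u ^+ n)); last by rewrite exprS; ring.
  rewrite ler_wpM2l// ler_pM2r ?exprn_gt0// ler_nat addn1 ltnS.
  by rewrite leq_pmull.
by rewrite -[leRHS]mulrA ler_wpM2l.
Qed.

(** The usual Lipschitz bound [n * e^(n-1)], multiplied by [e] so that no predecessor of [n]
    occurs. *)
Lemma expr_lipschitz (e x y : R) n : `|x| <= e -> `|y| <= e ->
  e * `|x ^+ n - y ^+ n| <= n%:R * e ^+ n * `|x - y|.
Proof.
move=> xe ye; have e0 : 0 <= e by exact: le_trans xe.
elim: n => [|n IH]; first by rewrite !expr0 subrr normr0 mulr0 mul0r mul0r.
rewrite (_ : x ^+ n.+1 - _ = x * (x ^+ n - y ^+ n) + (x - y) * y ^+ n); last first.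
  by rewrite !exprS; ring.
apply: (@le_trans _ _ (e * (e * `|x ^+ n - y ^+ n| + `|x - y| * e ^+ n))).
  rewrite ler_wpM2l// (le_trans (ler_normD _ _))// !normrM lerD//.
    by rewrite ler_wpM2r.
  by rewrite ler_wpM2l// normrX lerXn2r// nnegrE.
rewrite mulrDr exprS.
have : e * (e * `|x ^+ n - y ^+ n|) <= e * (n%:R * e ^+ n * `|x - y|) by rewrite ler_wpM2l.
move=> H; rewrite (_ : _ * _ * `|x - y| = e * (n%:R * e ^+ n * `|x - y|) + e * (`|x - y| * e ^+ n)).
  by rewrite lerD2r.
by rewrite -natr1; ring.
Qed.

(** At the rate [2 * rho], heights up to [(4 * rho)^-1] give the ratio 1/2; this fixes the
    half-width of the strip. *)
Lemma good_bound rho c : 0 < rho -> good rho c ->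
  exists2 C : R, 0 <= C & forall n x y, `|y| <= (4 * rho)^-1 ->
    `|c n x * y ^+ n| <= C * (1 / 2) ^+ n.
Proof.
move=> r0 [d gc]; have [|C adC] := gc (2 * rho); first by lra.
have C0 : 0 <= C by have := adm_ge0 (adC 0%N); rewrite expr0 mulr1.
exists C => // n x y ye.
rewrite (_ : 1 / 2 = 2 * rho * (4 * rho)^-1); last by field; rewrite gt_eqF.
rewrite exprMn mulrA normrM; apply: ler_pM => //; first exact: adm_bound (adC n) x.
by rewrite normrX lerXn2r// nnegrE// invr_ge0 mulr_ge0// ltW.
Qed.

(** The rate [3 / 2 * rho] leaves room below [2 * rho] for the linear factors that come from the
    Lipschitz constants of [c n] and of the [n]-th power; the final ratio is again 1/2. *)
Lemma good_lipschitz rho c : 0 < rho -> good rho c ->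
  exists2 C : R, 0 <= C & forall n x x' y y',
    `|y| <= (4 * rho)^-1 -> `|y'| <= (4 * rho)^-1 ->
    `|c n x' * y' ^+ n - c n x * y ^+ n|
      <= C * (1 / 2) ^+ n * (`|x' - x| + `|y' - y|).
Proof.
move=> r0 [d gc]; have [|C adC] := gc (3 / 2 * rho); first by lra.
have C0 : 0 <= C by have := adm_ge0 (adC 0%N); rewrite expr0 mulr1.
have [||K K0 HK] := @linear_le_geometric (3 / 2 * rho) (2 * rho) d; [lra|lra|].
set e := (4 * rho)^-1; have e0 : 0 < e by rewrite invr_gt0 mulr_gt0.
exists (C * K * (2 + e^-1)) => [|n x x' y y' ye y'e].
  by rewrite !mulr_ge0// addr_ge0// invr_ge0 ltW.
have -> : 1 / 2 = 2 * rho * e :> R by rewrite /e; field; rewrite gt_eqF.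
rewrite (_ : c n x' * _ - _ = (c n x' - c n x) * y' ^+ n + c n x * (y' ^+ n - y ^+ n)); last by ring.
set P := (2 * rho * e) ^+ n.
have P0 : 0 <= P by rewrite exprn_ge0// !mulr_ge0// ltW.
have HP : (2 * n + d)%:R * (3 / 2 * rho) ^+ n * e ^+ n <= K * P.
  by rewrite [P]exprMn [leRHS]mulrA ler_pM2r ?exprn_gt0.
apply: (@le_trans _ _ (C * K * 2 * P * `|x' - x| + C * K * e^-1 * P * `|y' - y|)); last first.
  rewrite -subr_ge0.
  rewrite [leRHS](_ : _ = C * K * e^-1 * P * `|x' - x| + C * K * 2 * P * `|y' - y|); last by ring.
  by rewrite addr_ge0// !mulr_ge0// invr_ge0 ltW.
rewrite (le_trans (ler_normD _ _))// lerD//.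
  rewrite normrM; apply: (@le_trans _ _
    (2 * (2 * n + d)%:R * (C * (3 / 2 * rho) ^+ n) * `|x' - x| * e ^+ n)).
    apply: ler_pM => //; first exact: adm_lipschitz.
    by rewrite normrX lerXn2r// nnegrE ltW.
  rewrite [leLHS](_ : _ = 2 * C * `|x' - x| *
    ((2 * n + d)%:R * (3 / 2 * rho) ^+ n * e ^+ n)); last by ring.
  rewrite [leRHS](_ : _ = 2 * C * `|x' - x| * (K * P)); last by ring.
  by rewrite ler_wpM2l// !mulr_ge0.
rewrite normrM -(ler_pM2l e0).
rewrite [leRHS](_ : _ = C * `|y' - y| * (K * P)); last by field; rewrite gt_eqF.
rewrite mulrCA.
apply: (@le_trans _ _ (C * (3 / 2 * rho) ^+ n * (n%:R * e ^+ n * `|y' - y|))).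
  apply: ler_pM => //; first by rewrite mulr_ge0// ltW.
    exact: adm_bound (adC n) x.
  exact: expr_lipschitz.
apply: le_trans (ler_wpM2l _ HP); last by rewrite mulr_ge0.
rewrite [leLHS](_ : _ = C * `|y' - y| * (n%:R * (3 / 2 * rho) ^+ n * e ^+ n)); last by ring.
rewrite ler_wpM2l ?mulr_ge0// !ler_pM2r ?exprn_gt0//; last by rewrite mulr_gt0.
by rewrite ler_nat mul2n -addnn -addnA leq_addr.
Qed.

End GoodSequences.

(** * Series dominated by a geometric series of ratio 1/2 *)

Section GeometricSeries.
Context {R : realType}.
Implicit Types (a b : nat -> R) (C : R).

Definition geo C a := forall n, `|a n| <= C * (1 / 2) ^+ n.

Lemma geo_ge0 C a : geo C a -> 0 <= C.
Proof. by move=> /(_ 0%N); rewrite expr0 mulr1; exact: le_trans. Qed.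

Lemma geo_sum_le C a m N : geo C a ->
  `|\sum_(m <= k < N) a k| <= 2 * C * (1 / 2) ^+ m.
Proof.
move=> aC; have C0 := geo_ge0 aC; have p0 n : 0 <= (1 / 2 : R) ^+ n by rewrite exprn_ge0.
have [mN|/ltnW Nm] := leqP m N; last first.
  by rewrite big_geq// normr0 !mulr_ge0.
(* Keeping the subtracted term makes the induction on the length close. *)
suff: `|\sum_(m <= k < N) a k| <= 2 * C * (1 / 2) ^+ m - 2 * C * (1 / 2) ^+ N.
  by move=> H; apply: le_trans H _; rewrite gerBl !mulr_ge0.
rewrite -(subnKC mN); elim: (N - m)%N => [|n IH].
  by rewrite addn0 big_geq// normr0 subrr.
rewrite addnS big_nat_recr ?leq_addr//=.
rewrite (le_trans (ler_normD _ _))//.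
apply: (le_trans (lerD IH (aC _))).
by rewrite le_eqVlt; apply/orP; left; apply/eqP; rewrite [in RHS]exprS; field.
Qed.

Lemma geo_cvg C a : geo C a -> cvgn (series a).
Proof.
move=> aC; apply: normed_cvg; apply: (@series_le_cvg _ _ (geometric C (1 / 2))).
- by move=> n; exact: normr_ge0.
- by move=> n; rewrite /= mulr_ge0 ?exprn_ge0// (geo_ge0 aC).
- by move=> n /=; exact: aC.
- by apply: is_cvg_geometric_series; rewrite ger0_norm//; lra.
Qed.

Lemma geo_tail C a N : geo C a ->
  `|limn (series a) - series a N| <= 2 * C * (1 / 2) ^+ N.
Proof.
move=> aC.
have cv : (fun m => `|series a m - series a N|) @ \oo --> `|limn (series a) - series a N|.
  by apply: cvg_norm; apply: cvgB; [exact: geo_cvg aC|exact: cvg_cst].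
rewrite -(cvg_lim _ cv)//; apply: limr_le; first by apply/cvg_ex; eexists; exact: cv.
near=> m; rewrite sub_series_geq; last by near: m; exact: nbhs_infty_ge.
exact: geo_sum_le.
Unshelve. all: by end_near. Qed.

Lemma geo_lim_le C a : geo C a -> `|limn (series a)| <= 2 * C.
Proof.
by move=> aC; have := geo_tail 0 aC; rewrite expr0 mulr1 /series /= big_geq// subr0.
Qed.

Lemma half_expr_lt C (e : R) : 0 < e -> exists N, C * (1 / 2) ^+ N < e.
Proof.
move=> e0; have := @cvg_geometric R C (1 / 2).
move=> /(_ ltac:(rewrite ger0_norm//; lra))/cvgrPdist_lt/(_ e e0)[N _ HN].
by exists N; have := HN N (leqnn N); rewrite /= sub0r normrN; exact/le_lt_trans/ler_norm.
Qed.

(** Dominated convergence for series: [geo_tail] makes both tails uniformly small, and the finitely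
    many remaining terms converge one by one. *)
Lemma tannery (T : Type) (F : set_system T) (FF : ProperFilter F) C
    (q : T -> nat -> R) (d : nat -> R) :
  (\forall t \near F, geo C (q t)) -> (forall n, q t n @[t --> F] --> d n) ->
  geo C d /\ limn (series (q t)) @[t --> F] --> limn (series d).
Proof.
move=> qC qd.
have dC : geo C d.
  move=> n; have cv : `|q t n| @[t --> F] --> `|d n| by exact: cvg_norm.
  rewrite -(cvg_lim _ cv)//; apply: limr_le; first by apply/cvg_ex; eexists; exact: cv.
  by apply: filterS qC => t; apply.
split=> //; apply/cvgrPdist_lt => e e0.
have [N HN] := half_expr_lt (2 * C) (e := e / 3) ltac:(lra).
have : \sum_(0 <= k < N) q t k @[t --> F] --> \sum_(0 <= k < N) d k.
  elim: N {HN} => [|N IH].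
    rewrite big_geq//; under eq_fun do rewrite big_geq//; exact: cvg_cst.
  rewrite big_nat_recr//; under eq_fun do rewrite big_nat_recr//=.
  exact: cvgD.
move/cvgrPdist_lt => /(_ (e / 3) ltac:(lra)) S.
near=> t.
have qt : geo C (q t) by near: t.
have St : `|\sum_(0 <= k < N) d k - \sum_(0 <= k < N) q t k| < e / 3 by near: t.
have := geo_tail N dC; have := geo_tail N qt.
rewrite /series /=; set Q := limn _; set D := limn _ => h1 h2.
rewrite (_ : D - Q = (D - \sum_(0 <= k < N) d k) +
   (\sum_(0 <= k < N) d k - \sum_(0 <= k < N) q t k)
   - (Q - \sum_(0 <= k < N) q t k)); last by ring.
have := ler_normB ((D - \sum_(0 <= k < N) d k) +
   (\sum_(0 <= k < N) d k - \sum_(0 <= k < N) q t k))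
   (Q - \sum_(0 <= k < N) q t k).
have := ler_normD (D - \sum_(0 <= k < N) d k)
   (\sum_(0 <= k < N) d k - \sum_(0 <= k < N) q t k).
lra.
Unshelve. all: by end_near. Qed.

Definition conv a b : nat -> R := fun n => \sum_(i < n.+1) a i * b (n - i)%N.

(** The triangle [i + j < N] is summed row by row. *)
Lemma series_conv a b N :
  series (conv a b) N = \sum_(i < N) a i * series b (N - i)%N.
Proof.
elim: N => [|N IH]; first by rewrite /series /= big_geq// big_ord0.
rewrite /series /= in IH *; rewrite big_nat_recr//= IH /conv !big_ord_recr /= subnn addrA -big_split /=.
congr (_ + _); last by rewrite subSnn big_nat1.
apply: eq_bigr => i _.
by rewrite -mulrDr subSn ?(ltnW (ltn_ord i))// big_nat_recr.
Qed.

Lemma series_finite a N : (forall n, (N <= n)%N -> a n = 0) ->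
  limn (series a) = \sum_(i < N) a i.
Proof.
move=> aN; apply: lim_near_cst => //; near=> m.
have Nm : (N <= m)%N by near: m; exact: nbhs_infty_ge.
rewrite /series /= (big_cat_nat (n := N))//= big_mkord [X in _ + X]big_nat.
by rewrite [X in _ + X]big1 ?addr0// => i /andP[/aN].
Unshelve. all: by end_near. Qed.

(* Mertens: [\sum_(i < N) a i * series b (N - i)] is dominated by [geo], so
   Tannery's theorem applies as [N] grows. *)
Lemma cauchy_product C D a b : geo C a -> geo D b ->
  series (conv a b) @ \oo --> limn (series a) * limn (series b).
Proof.
move=> aC bD; set B := limn (series b).
pose q N i := if (i < N)%N then a i * series b (N - i)%N else 0.
have C0 := geo_ge0 aC; have D0 := geo_ge0 bD.
have [|i|] := @tannery nat \oo _ (C * (2 * D)) q (fun i => a i * B).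
- near=> N; move=> i; rewrite /q; case: ifPn => _; last first.
    by rewrite normr0 !mulr_ge0// exprn_ge0.
  rewrite normrM mulrAC ler_pM//.
  by have := geo_sum_le 0 (N - i) bD; rewrite expr0 mulr1.
- apply: (@cvg_trans _ ((fun N => a i * series b (N - i)%N) @ \oo)).
    apply: near_eq_cvg; near=> N; rewrite /q ifT//.
    by near: N; exact: nbhs_infty_gt.
  apply: cvgM; first exact: cvg_cst.
  rewrite -(@cvg_shiftn i).
  under eq_fun do rewrite addnK.
  exact: geo_cvg bD.
- move=> _; set L := limn _.
  have -> : L = limn (series a) * B.
    apply: cvg_lim => //.
    rewrite [X in X @ _](_ : _ = (fun N => series a N * B)).
      by apply: cvgM; [exact: geo_cvg aC|exact: cvg_cst].
    by apply/funext => N; rewrite /series /= mulr_suml.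
  rewrite (_ : (fun t => _) = series (conv a b))//.
  apply/funext => N; rewrite series_conv (series_finite (N := N)).
    by apply: eq_bigr => i _; rewrite /q ltn_ord.
  by move=> n Nn; rewrite /q ltnNge Nn.
Unshelve. all: by end_near. Qed.

End GeometricSeries.

(** * Power series in [y] on a strip, and their derivatives *)

Section StripFunctions.
Context {R : realType}.
Implicit Types (c : nat -> R -> R) (rho : R).

Definition psum c (x y : R) : R := limn (series (fun n => c n x * y ^+ n)).

Lemma is_derive_cvg (V : normedModType R) (f : V -> R) (z v : V) (l : R) :
  is_derive z v f l <->
  t^-1 * (f (t *: v + z) - f z) @[t --> 0^'] --> l.
Proof.
split=> [[fz <-]//|H]; apply: DeriveDef; first by apply/cvg_ex; exists l.
exact: cvg_lim.
Qed.

(** Restriction to a line gives access to the chain rule of one real variable in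
    [is_derive_comp]. *)
Lemma is_derive_line (V : normedModType R) (f : V -> R) (z v : V) (l : R) :
  is_derive z v f l <-> is_derive (0 : R) 1 (fun t : R => f (t *: v + z)) l.
Proof.
rewrite !is_derive_cvg scale0r add0r.
by under [X in _ <-> X @ _ --> _]eq_fun do rewrite scaler1 addr0.
Qed.

Lemma is_derive_comp (V : normedModType R) (g : R -> R) (f : V -> R) (z v : V)
    (a b : R) :
  is_derive (f z) 1 g b -> is_derive z v f a ->
  is_derive z v (fun w => g (f w)) (b * a).
Proof.
move=> dg /is_derive_line df; apply/is_derive_line.
have dg' : is_derive (f (0 *: v + z)) 1 g b by rewrite scale0r add0r.
exact: (is_derive1_comp dg' df).
Qed.

Lemma derive_near_lipschitz (V : normedModType R) (f : V -> R) (z v : V) (a : R) :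
  is_derive z v f a ->
  \forall t \near (0 : R)^', `|f (t *: v + z) - f z| <= (`|a| + 1) * `|t|.
Proof.
move=> /is_derive_cvg H.
have /cvgrPdist_lt/(_ 1 ltr01) : `|t^-1 * (f (t *: v + z) - f z)| @[t --> 0^'] --> `|a|.
  exact: cvg_norm.
move=> H1; near=> t; have t0 : t != 0 by near: t; exact: nbhs_dnbhs_neq.
rewrite -ler_pdivrMr ?normr_gt0//.
have : `| `|a| - `|t^-1 * (f (t *: v + z) - f z)| | < 1 by near: t.
rewrite normrM normfV mulrC ltr_norml => /andP[h _]; rewrite ltW//; lra.
Unshelve. all: by end_near. Qed.

(** Tannery's theorem for the difference quotients as [t] tends to 0; the Lipschitz hypothesis
    dominates them. *)
Lemma is_derive_series (V : normedModType R) (f : nat -> V -> R) (df : nat -> R)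
    (z v : V) (C : R) :
  (forall n, is_derive z v (f n) (df n)) ->
  geo C (f^~ z) ->
  (\forall t \near (0 : R)^', forall n,
     `|f n (t *: v + z) - f n z| <= C * (1 / 2) ^+ n * `|t|) ->
  geo C df /\ is_derive z v (fun w => limn (series (f^~ w))) (limn (series df)).
Proof.
move=> fdf fC fL.
have [||dC H] := @tannery R R (0^') _ C
  (fun t n => t^-1 * (f n (t *: v + z) - f n z)) df.
- near=> t; move=> n; have t0 : t != 0 by near: t; exact: nbhs_dnbhs_neq.
  rewrite normrM normfV ler_pdivrMl ?normr_gt0// mulrC.
  by move: n; near: t.
- by move=> n; apply/is_derive_cvg.
split=> //; apply/is_derive_cvg; apply: cvg_trans H; apply: near_eq_cvg.
near=> t; have t0 : t != 0 by near: t; exact: nbhs_dnbhs_neq.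
have tL : forall n, `|f n (t *: v + z) - f n z| <= C * (1 / 2) ^+ n * `|t| by near: t.
have gt : geo (C * (1 + `|t|)) (f^~ (t *: v + z)).
  move=> n; have := ler_normD (f n (t *: v + z) - f n z) (f n z); rewrite subrK.
  move=> /le_trans; apply; apply: le_trans (lerD (tL n) (fC n)) _.
  by rewrite le_eqVlt; apply/orP; left; apply/eqP; ring.
rewrite -lim_seriesB; [|exact: geo_cvg gt|exact: geo_cvg fC].
by rewrite -[RHS]lim_seriesZ//; apply: is_cvg_seriesB; [exact: geo_cvg gt|exact: geo_cvg fC].
Unshelve. all: by end_near. Qed.

Lemma good_geo rho c (x y : R) : 0 < rho -> good rho c -> `|y| <= (4 * rho)^-1 ->
  exists C, geo C (fun n => c n x * y ^+ n).
Proof. by move=> r0 /(good_bound r0)[C _ H] ye; exists C => n; exact: H. Qed.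

Lemma psum_lipschitz rho c : 0 < rho -> good rho c ->
  exists C : R, forall x x' y y' : R,
    `|y| <= (4 * rho)^-1 -> `|y'| <= (4 * rho)^-1 ->
    `|psum c x' y' - psum c x y| <= C * (`|x' - x| + `|y' - y|).
Proof.
move=> r0 gc; have [C C0 HC] := good_lipschitz r0 gc.
exists (2 * C) => x x' y y' ye y'e.
have [A gA] := good_geo x r0 gc ye; have [B gB] := good_geo x' r0 gc y'e.
rewrite /psum -lim_seriesB; [|exact: geo_cvg gB|exact: geo_cvg gA].
rewrite -mulrA; apply: geo_lim_le => n /=.
by rewrite mulrAC; exact: HC.
Qed.

(** Termwise differentiation along arbitrary inner maps [X] and [Y], so that the chain rule for the
    later change of variables is built in. *)
Lemma is_derive_psum rho c (V : normedModType R) (X Y : V -> R) (z v : V) (a b : R) :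
  0 < rho -> good rho c -> (forall w, `|Y w| <= (4 * rho)^-1) ->
  is_derive z v X a -> is_derive z v Y b ->
  is_derive z v (fun w => psum c (X w) (Y w))
    (psum (coef_dx c) (X z) (Y z) * a + psum (coef_dy c) (X z) (Y z) * b).
Proof.
move=> r0 gc Ye dX dY.
pose f n w := c n (X w) * Y w ^+ n.
pose df n := coef_dx c n (X z) * Y z ^+ n * a + n%:R * c n (X z) * Y z ^+ n.-1 * b.
have [C C0 HC] := good_lipschitz r0 gc.
have [C1 C10 HC1] := good_bound r0 gc.
have fdf n : is_derive z v (f n) (df n).
  have [d gd] := gc; have [|A /(_ n) aA] := gd (2 * rho); first by lra.
  have dc : is_derive (X z) 1 (c n) (coef_dx c n (X z)).
    by rewrite /coef_dx derive1E; apply: derivableP; exact: adm_derivable aA.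
  have dp : is_derive (Y z) 1 (fun y : R => y ^+ n) (n%:R * Y z ^+ n.-1).
    apply: DeriveDef; first exact: exprn_derivable.
    by rewrite exp_derive /GRing.scale /= mulr1 mulr_natl.
  apply: is_derive_coef (is_derive_mul (is_derive_comp dc dX) (is_derive_comp dp dY)) _.
  by rewrite /df; ring.
pose K := (`|a| + 1) + (`|b| + 1).
have K0 : 0 <= K by rewrite !addr_ge0.
have [||gdf H] := is_derive_series (C := C * K + C1) fdf.
- move=> n; apply: (le_trans (HC1 n (X z) (Y z) (Ye z))).
  by rewrite ler_wpM2r ?exprn_ge0// lerDr mulr_ge0.
- have HX := derive_near_lipschitz dX; have HY := derive_near_lipschitz dY.
  near=> t; move=> n.
  apply: (le_trans (HC n _ _ _ _ (Ye z) (Ye _))).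
  apply: (@le_trans _ _ (C * (1 / 2) ^+ n * (K * `|t|))).
    rewrite ler_wpM2l ?mulr_ge0 ?exprn_ge0// mulrDl lerD//; first by near: t.
    by near: t.
  rewrite mulrA ler_wpM2r// mulrAC ler_wpM2r ?exprn_ge0//.
  by rewrite lerDl.
apply: is_derive_coef H _.
have [A gA] := good_geo (X z) r0 (good_coef_dx r0 gc) (Ye z).
have [B gB] := good_geo (X z) r0 (good_coef_dy r0 gc) (Ye z).
(* The [Y] part of term 0 vanishes and that of term [n.+1] is term [n] of the [coef_dy] series,
   hence one more term in the [X] sum than in the [Y] sum. *)
apply: cvg_lim => //; rewrite -cvg_shiftS.
pose u n := coef_dx c n (X z) * Y z ^+ n.
pose w n := coef_dy c n (X z) * Y z ^+ n.
rewrite (_ : (fun n => _) = (fun n => series u n.+1 * a + series w n * b)).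
  apply: cvgD; apply: cvgM; try exact: cvg_cst; last exact: geo_cvg gB.
  by rewrite (cvg_shiftS (series u)); exact: geo_cvg gA.
apply/funext => n; rewrite /series /= /df big_split /= -!mulr_suml; congr (_ + _ * _).
rewrite big_nat_recl// !mul0r add0r; apply: eq_bigr => i _.
by rewrite /w /coef_dy.
Unshelve. all: by end_near. Qed.

End StripFunctions.

(** * The holomorphic map onto a thin strip, and an algebra of functions stable under
    differentiation *)

Section LogStrip.
Context {R : realType} (r h rho : R).
Hypotheses (h0 : 0 < h) (rho0 : 0 < rho) (h_rho : h * (pi / 2) <= (4 * rho)^-1).
Implicit Types (x y : R).

(** The squared modulus of [1 - r * (x + i * y)]. *)
Definition sqdist x y : R := (1 - r * x) ^+ 2 + (r * y) ^+ 2.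

(* [logre + i logim] is [- h * log (1 - r * (x + i * y))]; it maps the half-plane
   [r * x < 1] into a thin strip around the real axis. *)
Definition logre x y : R := - (h / 2) * ln (sqdist x y).
Definition logim x y : R := h * atan (r * y / (1 - r * x)).

(** The two partial derivatives of [logre]; [cauchy_re - i cauchy_im] is the complex derivative
    [h * r / (1 - r * (x + i * y))]. *)
Definition cauchy_re x y : R := h * r * (1 - r * x) * (sqdist x y)^-1.
Definition cauchy_im x y : R := - (h * r * (r * y)) * (sqdist x y)^-1.

Lemma sqdist_gt0 x y : r * x < 1 -> 0 < sqdist x y.
Proof. by move=> rx; rewrite ltr_pwDl ?sqr_ge0// exprn_gt0// subr_gt0. Qed.

(** [atan] is bounded by [pi / 2] everywhere, so the bound is global, as [is_derive_psum] asks of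
    [Y]. *)
Lemma logim_le x y : `|logim x y| <= (4 * rho)^-1.
Proof.
apply: le_trans h_rho; rewrite normrM gtr0_norm// ler_pM2l// ler_norml.
by rewrite !ltW ?atan_gtNpi2 ?atan_ltpi2.
Qed.

Section Derivatives.
Context {V : normedModType R} (xi up : V -> R).
Let Q z := sqdist (xi z) (up z).

Lemma is_derive_sqdist (z v : V) (a b : R) : is_derive z v xi a -> is_derive z v up b ->
  is_derive z v (fun w => sqdist (xi w) (up w))
    (- (2 * r * (1 - r * xi z)) * a + 2 * r * (r * up z) * b).
Proof.
move=> da db; rewrite /sqdist; under eq_fun do rewrite !expr2.
have d1 := is_derive_add (is_derive_const 1 z v)
  (is_derive_scale (-1) (is_derive_scale r da)).
have d1' : is_derive z v (fun w => 1 - r * xi w) (- (r * a)).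
  by rewrite -[- (r * a)]mulN1r -[X in is_derive _ _ _ X]add0r;
     under eq_fun do rewrite -mulN1r.
have d2 := is_derive_scale r db.
have K := is_derive_add (is_derive_mul d1' d1') (is_derive_mul d2 d2).
apply: (is_derive_coef K).
by ring.
Qed.

Lemma is_derive_logre (z v : V) (a b : R) : r * xi z < 1 ->
  is_derive z v xi a -> is_derive z v up b ->
  is_derive z v (fun w => logre (xi w) (up w))
    (cauchy_re (xi z) (up z) * a + cauchy_im (xi z) (up z) * b).
Proof.
move=> rz da db; have Q0 := sqdist_gt0 (up z) rz.
have K := is_derive_scale (- (h / 2)) (is_derive_comp
  (f := fun w => sqdist (xi w) (up w)) (is_derive1_ln Q0) (is_derive_sqdist da db)).
apply: (is_derive_coef K).
by rewrite /cauchy_re /cauchy_im; field; exact: lt0r_neq0.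
Qed.

Lemma is_derive_logim (z v : V) (a b : R) : r * xi z < 1 ->
  is_derive z v xi a -> is_derive z v up b ->
  is_derive z v (fun w => logim (xi w) (up w))
    (cauchy_re (xi z) (up z) * b - cauchy_im (xi z) (up z) * a).
Proof.
move=> rz da db; have Q0 := sqdist_gt0 (up z) rz.
have d1 : is_derive z v (fun w => 1 - r * xi w) (- (r * a)).
  have := is_derive_add (is_derive_const 1 z v)
    (is_derive_scale (-1) (is_derive_scale r da)).
  by rewrite add0r mulN1r; under eq_fun do rewrite mulN1r.
have n0 : 1 - r * xi z != 0 by rewrite gt_eqF// subr_gt0.
have d2 := is_derive_mul (is_derive_scale r db)
  (is_derive_inv (f := fun w => 1 - r * xi w) n0 d1).
have := is_derive_scale h (is_derive_comp
  (f := fun w => r * up w / (1 - r * xi w)) (is_derive1_atan (r * up z / (1 - r * xi z))) d2) => K.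
apply: is_derive_coef K _.
rewrite /cauchy_re /cauchy_im /sqdist; field.
by rewrite n0 andbT; exact: lt0r_neq0.
Qed.

End Derivatives.

(** Leaving [xi] and [up] abstract lets one class serve both for the coordinates on the disk and for
    [cos] and [sin] on the circle. *)
Inductive gcl (V : Type) (xi up : V -> R) : (V -> R) -> Prop :=
| gcl_cst a : gcl xi up (fun=> a)
| gcl_xi : gcl xi up xi
| gcl_up : gcl xi up up
| gcl_sqdist : gcl xi up (fun z => (sqdist (xi z) (up z))^-1)
| gcl_psum c : good rho c ->
    gcl xi up (fun z => psum c (logre (xi z) (up z)) (logim (xi z) (up z)))
| gcl_add f g : gcl xi up f -> gcl xi up g -> gcl xi up (fun z => f z + g z)
| gcl_mul f g : gcl xi up f -> gcl xi up g -> gcl xi up (fun z => f z * g z).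

Lemma gcl_cauchy_re (V : Type) (xi up : V -> R) :
  gcl xi up (fun z => cauchy_re (xi z) (up z)).
Proof.
have H := gcl_mul (gcl_cst xi up (h * r)) (gcl_add (gcl_cst xi up 1)
  (gcl_mul (gcl_cst xi up (- r)) (gcl_xi xi up))).
have := gcl_mul H (gcl_sqdist xi up).
by under eq_fun do rewrite mulNr.
Qed.

Lemma gcl_cauchy_im (V : Type) (xi up : V -> R) :
  gcl xi up (fun z => cauchy_im (xi z) (up z)).
Proof.
have H := gcl_mul (gcl_cst xi up (- (h * r * r))) (gcl_up xi up).
have := gcl_mul H (gcl_sqdist xi up).
by under eq_fun do rewrite mulNr -[h * r * r * _]mulrA.
Qed.

(** Each generator has a derivative expressible in the generators, given that [xi] and [up] do; a
    series passes to those of [coef_dx] and [coef_dy]. *)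
Lemma gcl_is_derive (V : normedModType R) (xi up dxi dup : V -> R) (v : V) :
  (forall z, is_derive z v xi (dxi z)) -> (forall z, is_derive z v up (dup z)) ->
  gcl xi up dxi -> gcl xi up dup ->
  forall f, gcl xi up f ->
  exists2 f', gcl xi up f' & forall z, r * xi z < 1 -> is_derive z v f (f' z).
Proof.
move=> dx du gdx gdu f; elim=> {f}.
- by move=> a; exists (fun=> 0); [exact: gcl_cst|move=> z _; exact: is_derive_const].
- by exists dxi.
- by exists dup.
- exists (fun z => (-1 * ((sqdist (xi z) (up z))^-1 * (sqdist (xi z) (up z))^-1)) *
    (- 2 * r * (1 + - r * xi z) * dxi z + 2 * r * (r * up z) * dup z)).
    have gi := gcl_sqdist xi up; have gx := gcl_xi xi up; have gu := gcl_up xi up.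
    apply: gcl_mul; first by apply: (gcl_mul (gcl_cst xi up (-1))); exact: gcl_mul.
    apply: gcl_add; apply: gcl_mul => //.
      apply: (gcl_mul (gcl_cst xi up (- 2 * r))); apply: (gcl_add (gcl_cst xi up 1)).
      exact: (gcl_mul (gcl_cst xi up (- r))).
    apply: (gcl_mul (gcl_cst xi up (2 * r))); exact: (gcl_mul (gcl_cst xi up r)).
  move=> z rz; have n0 := lt0r_neq0 (sqdist_gt0 (up z) rz).
  apply: is_derive_coef (is_derive_inv (f := fun w => sqdist (xi w) (up w)) n0
    (is_derive_sqdist (dx z) (du z))) _.
  by field.
- move=> c gc.
  exists (fun z => psum (coef_dx c) (logre (xi z) (up z)) (logim (xi z) (up z)) *
      (cauchy_re (xi z) (up z) * dxi z + cauchy_im (xi z) (up z) * dup z) +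
    psum (coef_dy c) (logre (xi z) (up z)) (logim (xi z) (up z)) *
      (cauchy_re (xi z) (up z) * dup z + -1 * (cauchy_im (xi z) (up z) * dxi z))).
    have gr := gcl_cauchy_re xi up; have gi := gcl_cauchy_im xi up.
    apply: gcl_add; apply: gcl_mul.
    + exact: gcl_psum (good_coef_dx rho0 gc).
    + by apply: gcl_add; exact: gcl_mul.
    + exact: gcl_psum (good_coef_dy rho0 gc).
    + apply: gcl_add; first exact: gcl_mul.
      by apply: (gcl_mul (gcl_cst xi up (-1))); exact: gcl_mul.
  move=> z rz; rewrite mulN1r; apply: (is_derive_psum rho0 gc).
  + by move=> w; exact: logim_le.
  + exact: is_derive_logre.
  + exact: is_derive_logim.
- move=> f g _ [f' gf df] _ [g' gg dg]; exists (fun z => f' z + g' z).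
    exact: gcl_add.
  by move=> z rz; exact: is_derive_add (df z rz) (dg z rz).
- move=> f g Gf [f' gf df] Gg [g' gg dg]; exists (fun z => f z * g' z + f' z * g z).
    by apply: gcl_add; exact: gcl_mul.
  by move=> z rz; exact: is_derive_mul (df z rz) (dg z rz).
Qed.

Lemma gcl_continuous (T : topologicalType) (xi up : T -> R) :
  continuous xi -> continuous up ->
  forall f, gcl xi up f -> forall z, r * xi z < 1 -> {for z, continuous f}.
Proof.
move=> cx cu f + z rz; have Q0 := sqdist_gt0 (up z) rz.
have n0 : 1 - r * xi z != 0 by rewrite gt_eqF// subr_gt0.
have c1 : (1 - r * xi w) @[w --> z] --> 1 - r * xi z.
  by apply: cvgB; [exact: cvg_cst|apply: cvgMr; exact: cx].
have c2 : (r * up w) @[w --> z] --> r * up z by apply: cvgMr; exact: cu.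
have cQ : sqdist (xi w) (up w) @[w --> z] --> sqdist (xi z) (up z).
  by apply: cvgD; rewrite expr2; under eq_fun do rewrite expr2; exact: cvgM.
have cX : logre (xi w) (up w) @[w --> z] --> logre (xi z) (up z).
  by apply: cvgMr; exact: (continuous_cvg _ (continuous_ln Q0) cQ).
have cY : logim (xi w) (up w) @[w --> z] --> logim (xi z) (up z).
  have c3 : (r * up w / (1 - r * xi w)) @[w --> z] --> r * up z / (1 - r * xi z).
    by apply: cvgM => //; exact: cvgV.
  by apply: cvgMr; exact: (continuous_cvg _ (@continuous_atan _ _) c3).
elim=> {f}.
- by move=> a; exact: cvg_cst.
- exact: cx.
- exact: cu.
- by apply: cvgV => //; exact: lt0r_neq0.
- move=> c gc; have [C HC] := psum_lipschitz rho0 gc.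
  set X := fun w => logre (xi w) (up w); set Y := fun w => logim (xi w) (up w).
  rewrite /continuous_at; apply/cvgrPdist_lt => e e0.
  have : `|C| * (`|X w - X z| + `|Y w - Y z|) @[w --> z] --> `|C| * (`|X z - X z| + `|Y z - Y z|).
    apply: cvgMr; apply: cvgD; apply: cvg_norm; apply: cvgB => //; exact: cvg_cst.
  rewrite !subrr normr0 addr0 mulr0 => /cvgrPdist_lt/(_ _ e0); apply: filterS => w.
  rewrite sub0r normrN => H; rewrite distrC; apply: le_lt_trans H.
  rewrite normrM normr_id [X in _ <= _ * X]ger0_norm ?addr_ge0//.
  apply: (le_trans (HC _ _ _ _ (logim_le _ _) (logim_le _ _))).
  by rewrite ler_wpM2r ?addr_ge0// ler_norm.
- by move=> f g _ cf _ cg; exact: cvgD.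
- by move=> f g _ cf _ cg; exact: cvgM.
Qed.

End LogStrip.

(** * The Cauchy problem on the strip, solved by power series *)

Section CauchyProblem.
Context {R : realType}.
Implicit Types (x y rho : R) (c : 'I_3 -> nat -> R -> R).

Lemma second_order_recursion (X : Type) (a b : X) (F : (nat -> X) -> nat -> X) :
  (forall u v n, (forall k, (k <= n.+1)%N -> u k = v k) -> F u n = F v n) ->
  exists u, [/\ u 0%N = a, u 1%N = b & forall n, u n.+2 = F u n].
Proof.
move=> FE.
(* [tab n] lists the values up to index [n.+1]; beyond that [nth] returns the default [a], where
   [F _ n] does not look. *)
pose tab := fix tab n := if n is m.+1 then rcons (tab m) (F (nth a (tab m)) m) else [:: a; b].
have size_tab n : size (tab n) = n.+2 by elim: n => //= n IH; rewrite size_rcons IH.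
have tabS m n k : (k < m.+2)%N -> nth a (tab (m + n)%N) k = nth a (tab m) k.
  move=> km; elim: n => [|n IH]; first by rewrite addn0.
  by rewrite addnS /= nth_rcons size_tab (leq_trans km) ?IH// !ltnS leq_addr.
exists (fun n => nth a (tab n) n); split=> // n.
have -> : nth a (tab n.+2) n.+2 = nth a (tab n.+1) n.+2.
  by have := tabS n.+1 1%N n.+2 (ltnSn _); rewrite addn1.
rewrite [tab n.+1]/= nth_rcons size_tab ltnn eqxx; apply: FE => k kn.
have [->|kn'] := eqVneq k n.+1.
  by have := tabS n 1%N n.+1 (ltnSn _); rewrite addn1.
have {}kn : (k <= n)%N by move: kn; rewrite leq_eqVlt (negPf kn') ltnS.
by have := tabS k (n - k)%N k (ltnW (ltnSn _)); rewrite subnKC.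
Qed.

(** The coefficient of [y^n] in the system, solved for the coefficient of index [n.+2]. Signs appear
    as [-1 *] to match [adm_scale]. *)
Definition Hstep (u : nat -> 'I_3 -> R -> R) (n : nat) (i : 'I_3) (x : R) : R :=
  (n.+1%:R * n.+2%:R)^-1 *
  (-1 * derive1 (derive1 (u n i)) x +
   2 * \sum_(l < n.+1)
     (derive1 (u l (i + 1)) x * ((n - l).+1%:R * u (n - l).+1 (i + 2%:R) x) +
      -1 * (derive1 (u l (i + 2%:R)) x * ((n - l).+1%:R * u (n - l).+1 (i + 1) x)))).

Definition Hcoefs c := forall n i x,
  n.+1%:R * n.+2%:R * c i n.+2 x =
  - derive1 (derive1 (c i n)) x +
  2 * (conv (fun l => coef_dx (c (i + 1)) l x) (fun l => coef_dy (c (i + 2%:R)) l x) n -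
       conv (fun l => coef_dx (c (i + 2%:R)) l x) (fun l => coef_dy (c (i + 1)) l x) n).

(** The weights in the hypotheses cancel the factors from differentiation:
    [2 * (2 * l + 1) / l.+1 <= 4] for [f], and [(m + 1) / (m + 2) <= 1] with [m = n - l] for [g].
    The bound is thus uniform in [l]. *)
Lemma adm_product (B rho : R) (f g : R -> R) (n l : nat) :
  0 < rho -> (l <= n)%N ->
  adm (2 * l + 1) (B * rho ^+ l / l.+1%:R) f ->
  adm (2 * (n - l).+1 + 1) (B * rho ^+ (n - l).+1 / (n - l).+2%:R) g ->
  adm (2 * n.+2 + 1) (4 * B ^+ 2 * rho ^+ n.+1)
    (fun x => derive1 f x * ((n - l).+1%:R * g x)).
Proof.
move=> r0 ln af ag.
have := adm_mul (adm_derive1 af) (adm_scale (n - l).+1%:R ag).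
apply: adm_weaken.
  by rewrite -[in (_ <= 2 * n.+2 + 1)%N](subnKC ln); lia.
have -> : n.+1 = (l + (n - l).+1)%N by rewrite addnS subnKC.
have B0 : 0 <= B.
  have := adm_ge0 af; rewrite -mulrA pmulr_lge0// divr_gt0// exprn_gt0//.
rewrite exprD ger0_norm//; move: (n - l)%N => m.
set p := rho ^+ l; set q := rho ^+ m.+1.
have p0 : 0 <= p by rewrite exprn_ge0// ltW.
have q0 : 0 <= q by rewrite exprn_ge0// ltW.
rewrite [leLHS](_ : _ = (2 * (2 * l + 1)%:R / l.+1%:R) * (m.+1%:R / m.+2%:R) * (B ^+ 2 * (p * q))); last by ring.
rewrite -[leRHS]mulrA [leRHS]mulrCA [in leRHS]mulrA.
have H1 : 2 * (2 * l + 1)%:R / l.+1%:R <= 4 :> R.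
  by rewrite ler_pdivrMr// -!natrM ler_nat; lia.
have H2 : m.+1%:R / m.+2%:R <= 1 :> R by rewrite ler_pdivrMr// mul1r ler_nat.
have -> : B ^+ 2 * 4 * (p * q) = 4 * 1 * (B ^+ 2 * (p * q)) by ring.
by rewrite ler_wpM2r ?mulr_ge0 ?sqr_ge0// ler_pM// divr_ge0.
Qed.

(** Strong induction on the bound [B * rho ^+ n / n.+1%:R] in degree [2 * n + 1]. *)
Lemma Hcoefs_exist (B : R) (gamma : 'I_3 -> R -> R) :
  (forall i, adm 1 B (gamma i)) ->
  exists rho c, [/\ 0 < rho, forall i, c i 0%N = gamma i,
    forall i, good rho (c i) & Hcoefs c].
Proof.
move=> gB; have B0 : 0 <= B by exact: adm_ge0 (gB 0).
have [u [u0 u1 uS]] : exists u, [/\ u 0%N = gamma, u 1%N = (fun _ _ => 0) &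
    forall n, u n.+2 = Hstep u n].
  apply: second_order_recursion => v w n vw; apply/funext => i; apply/funext => x.
  rewrite /Hstep vw//; congr (_ * (_ + _ * _)); apply: eq_bigr => l _.
  have ln : (l <= n.+1)%N by rewrite ltnW.
  by rewrite (vw l ln) (vw (n - l).+1)// ltnS leq_subr.
(* Large enough for [B * rho <= rho ^+ 2 / 48] and [48 <= rho ^+ 2 / 48], the inequalities that
   close the induction. *)
pose rho := 48 * (B + 1); have r0 : 0 < rho by rewrite /rho; lra.
have adu n : forall i, adm (2 * n + 1) (B * rho ^+ n / n.+1%:R) (u n i).
  elim/ltn_ind: n => -[_ i|[_ i|n IH i]].
  - by rewrite u0 expr0 divr1 mulr1; exact: gB.
  - rewrite u1; apply: (adm_weaken _ _ (adm_cst 0)) => //.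
    by rewrite normr0 divr_ge0// mulr_ge0// exprn_ge0// ltW.
  rewrite uS /Hstep.
  set N := (2 * n.+2 + 1)%N.
  have a1 : adm N (4 * (2 * n + 1)%:R * (2 * n + 2)%:R * (B * rho ^+ n / n.+1%:R))
      (derive1 (derive1 (u n i))).
    have := adm_derive1 (adm_derive1 (IH n (ltnW (ltnSn _)) i)); apply: adm_weaken.
      by rewrite /N; lia.
    by rewrite le_eqVlt; apply/orP; left; apply/eqP; rewrite -[(2 * n + 1).+1]addn1 -addnA; ring.
  have a2 : adm N (\sum_(l < n.+1) (8 * B ^+ 2 * rho ^+ n.+1)) (fun x => \sum_(l < n.+1)
     (derive1 (u l (i + 1)) x * ((n - l).+1%:R * u (n - l).+1 (i + 2%:R) x) +
      -1 * (derive1 (u l (i + 2%:R)) x * ((n - l).+1%:R * u (n - l).+1 (i + 1) x)))).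
    apply: adm_sum => l; have ln : (l <= n)%N by rewrite -ltnS.
    have Hl j : adm (2 * l + 1) (B * rho ^+ l / l.+1%:R) (u l j).
      by apply: IH; rewrite ltnS ltnW.
    have Hnl j : adm (2 * (n - l).+1 + 1) (B * rho ^+ (n - l).+1 / (n - l).+2%:R) (u (n - l).+1 j).
      by apply: IH; rewrite !ltnS leq_subr.
    have := adm_add (adm_product r0 ln (Hl (i + 1)) (Hnl (i + 2%:R)))
      (adm_scale (-1) (adm_product r0 ln (Hl (i + 2%:R)) (Hnl (i + 1)))).
    apply: adm_weaken => //; rewrite normrN normr1.
    by rewrite le_eqVlt; apply/orP; left; apply/eqP; ring.
  have := adm_scale (n.+1%:R * n.+2%:R)^-1 (adm_add (adm_scale (-1) a1) (adm_scale 2 a2)).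
  apply: adm_weaken => //.
  rewrite normrN normr1 mul1r !ger0_norm ?invr_ge0 ?mulr_ge0//.
  rewrite sumr_const card_ord -mulr_natl.
  set q := rho ^+ n; have q0 : 0 <= q by rewrite exprn_ge0// ltW.
  rewrite -[n.+3]addn3 -[n.+2]addn2 -[n.+1]addn1 !exprD expr1 -/q !natrD ?natrM.
  set t : R := n%:R; have t0 : 0 <= t by rewrite ler0n.
  rewrite ler_pdivrMl; last by rewrite mulr_gt0//; lra.
  rewrite [leRHS]mulrA ler_pdivlMr; last by lra.
  have t1 : t + 1 != 0 by rewrite gt_eqF//; lra.
  rewrite [leLHS](_ : _ = (8 * (2 * t + 1) + 16 * (t + 1) * (B * rho)) * (t + 3) * (B * q)); last by field.
  rewrite [leRHS](_ : _ = (t + 1) * (t + 2) * rho ^+ 2 * (B * q)); last by ring.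
  rewrite ler_wpM2r ?mulr_ge0//.
  have s1 : B * rho <= rho ^+ 2 / 48 by rewrite /rho expr2; nra.
  have s2 : 48 <= rho ^+ 2 / 48 by rewrite /rho expr2; nra.
  move: (B * rho) (rho ^+ 2) s1 s2 (mulr_ge0 B0 (ltW r0)) => b w s1 s2 b0.
  (* The second derivative takes one share of [(t + 1) * (w / 48)] and the products take 16; then
     [17 * (t + 3) <= 48 * (t + 2)]. *)
  apply: (@le_trans _ _ (17 * (t + 1) * (w / 48) * (t + 3))).
    apply: ler_wpM2r; first by lra.
    rewrite [leRHS](_ : _ = (t + 1) * (w / 48) + 16 * (t + 1) * (w / 48)); last by field.
    apply: lerD; last by rewrite ler_wpM2l// mulr_ge0//; lra.
    by nra.
  rewrite -mulrA [X in _ * _ * X <= _]mulrC mulrA mulrAC; nra.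
exists rho, (fun i n => u n i); split=> // [i|i|n i x].
- by rewrite u0.
- exists 1%N => s rs; exists B => n; apply: (adm_weaken _ _ (adu n i)) => //.
  rewrite ler_pdivrMr//; apply: (@le_trans _ _ (B * s ^+ n)).
    by rewrite ler_wpM2l// lerXn2r// ?nnegrE ltW// (lt_trans r0).
  by rewrite ler_peMr ?ler1n// mulr_ge0// exprn_ge0// ltW// (lt_trans r0).
- rewrite uS /Hstep mulrA divff ?mul1r; last by rewrite mulf_neq0.
  rewrite mulN1r; congr (_ + _ * _).
  by rewrite /conv -sumrB; apply: eq_bigr => l _; rewrite mulN1r.
Qed.

(** The coefficient identities are multiplied by [y ^+ n] and summed; [cauchy_product] turns
    convolutions into products. *)
Lemma psum_Hsystem rho c : 0 < rho -> (forall i, good rho (c i)) -> Hcoefs c ->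
  forall i x y, `|y| <= (4 * rho)^-1 ->
  psum (coef_dx (coef_dx (c i))) x y + psum (coef_dy (coef_dy (c i))) x y =
  2 * (psum (coef_dx (c (i + 1))) x y * psum (coef_dy (c (i + 2%:R))) x y -
       psum (coef_dx (c (i + 2%:R))) x y * psum (coef_dy (c (i + 1))) x y).
Proof.
move=> r0 gc Hc i x y ye.
pose a j n := coef_dx (c j) n x * y ^+ n; pose b j n := coef_dy (c j) n x * y ^+ n.
have [A1 gA1] := good_geo x r0 (good_coef_dx r0 (gc (i + 1))) ye.
have [A2 gA2] := good_geo x r0 (good_coef_dx r0 (gc (i + 2%:R))) ye.
have [B1 gB1] := good_geo x r0 (good_coef_dy r0 (gc (i + 1))) ye.
have [B2 gB2] := good_geo x r0 (good_coef_dy r0 (gc (i + 2%:R))) ye.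
have [X gX] := good_geo x r0 (good_coef_dx r0 (good_coef_dx r0 (gc i))) ye.
have [Y gY] := good_geo x r0 (good_coef_dy r0 (good_coef_dy r0 (gc i))) ye.
have C12 := cauchy_product gA1 gB2; have C21 := cauchy_product gA2 gB1.
pose S N := series (fun n => coef_dx (coef_dx (c i)) n x * y ^+ n) N +
  series (fun n => coef_dy (coef_dy (c i)) n x * y ^+ n) N.
transitivity (limn S).
  by apply/esym/cvg_lim => //; apply: cvgD; [exact: geo_cvg gX|exact: geo_cvg gY].
apply: cvg_lim => //.
rewrite (_ : S = fun N => 2 * (series (conv (a (i + 1)) (b (i + 2%:R))) N -
    series (conv (a (i + 2%:R)) (b (i + 1))) N)); last first.
  apply/funext => N; rewrite /S /series /=.
  rewrite -big_split /= -sumrB mulr_sumr; apply: eq_bigr => n _.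
have convE (p q : nat -> R) :
      conv (fun l => p l * y ^+ l) (fun l => q l * y ^+ l) n = conv p q n * y ^+ n.
  rewrite /conv mulr_suml; apply: eq_bigr => l _.
  have ln : (l <= n)%N by rewrite -ltnS.
  have -> : y ^+ n = y ^+ l * y ^+ (n - l) by rewrite -exprD subnKC.
  by ring.
rewrite [conv (a _) _ n]convE [conv (a _) _ n]convE -mulrBl mulrA -mulrDl.
congr (_ * _); have := Hc n i x.
rewrite [X in X = _ -> _](_ : _ = coef_dy (coef_dy (c i)) n x); last first.
  by rewrite /coef_dy mulrA.
by move=> ->; rewrite addrA subrr add0r.
by apply: cvgM; [exact: cvg_cst|exact: cvgB].
Qed.

Lemma psum_axis (c : nat -> R -> R) x : psum c x 0 = c 0%N x.
Proof.
rewrite /psum (series_finite (N := 1)); first by rewrite big_ord1 expr0 mulr1.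
by move=> [//|n] _; rewrite expr0n mulr0.
Qed.

End CauchyProblem.

(** * Pulling the strip solution back to the disk *)

Section DiskSolution.
Context {R : realType} (r h rho : R).
Hypotheses (r0 : 0 < r) (r1 : r < 1) (h0 : 0 < h) (rho0 : 0 < rho).
Hypothesis h_rho : h * (pi / 2) <= (4 * rho)^-1.

Local Notation V2 := 'rV[R]_2.
Local Notation V3 := 'rV[R]_3.
Let xi (z : V2) : R := z 0 0.
Let up (z : V2) : R := z 0 1.
Let gdisk := gcl r h rho xi up.

Definition strip_row (c : 'I_3 -> nat -> R -> R) (z : V2) : V3 :=
  \row_i psum (c i) (logre r h (z 0 0) (z 0 1)) (logim r h (z 0 0) (z 0 1)).

Lemma is_derive_row (V : normedModType R) (f : V -> V3) (z v : V) (l : 'I_3 -> R) :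
  (forall j, is_derive z v (fun w => f w 0 j) (l j)) ->
  derivable f z v /\ 'D_v f z = \row_j l j.
Proof.
move=> fl; have df : derivable f z v.
  by apply/derivable_mxP => i j; rewrite (ord1 i); case: (fl j).
split=> //; rewrite derive_mx//; apply/rowP => j; rewrite !mxE.
by rewrite (@derive_val _ _ _ _ _ _ _ (fl j)).
Qed.

Lemma continuous_row (T : topologicalType) (f : T -> V3) (z : T) :
  (forall j, {for z, continuous (fun w => f w 0 j)}) -> {for z, continuous f}.
Proof.
move=> cf; apply/cvgrPdist_le => e e0; near=> w.
rewrite [leLHS]/Num.Def.normr/= mx_normrE (bigmax_le _ (ltW e0))//= => -[i j] _.
rewrite !mxE /= (ord1 i) {i}; move: j; near: w; apply: filter_forall => j.
exact: (cvgrPdist_le _ _).1 (cf j) _ e0.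
Unshelve. all: by end_near. Qed.

Lemma enorm_coord n (z : 'rV[R]_n) i : `|z 0 i| <= enorm z.
Proof.
rewrite -sqrtr_sqr; apply: ler_wsqrtr; rewrite (bigD1 i)//= lerDl.
by apply: sumr_ge0 => j _; exact: sqr_ge0.
Qed.

Lemma closed_disk_halfplane (z : V2) : eclosed_ball 0 1 z -> r * z 0 0 < 1.
Proof.
rewrite /eclosed_ball /= subr0 => z1.
have := le_trans (le_trans (ler_norm _) (enorm_coord z 0)) z1 => h1.
by apply: le_lt_trans r1; rewrite ger_pMr.
Qed.

Lemma unit_disk_halfplane (z : V2) : unit_disk z -> r * z 0 0 < 1.
Proof. by move=> /ltW; exact: closed_disk_halfplane. Qed.

Lemma enorm_continuous n (z : 'rV[R]_n) : {for z, continuous (@enorm R n)}.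
Proof.
suff cS : {for z, continuous (fun w : 'rV[R]_n => \sum_(i < n) w 0 i ^+ 2)}.
  exact: (continuous_cvg _ (@sqrt_continuous R _) cS).
elim: (index_enum _) => [|i s IH].
  rewrite (_ : (fun _ => _) = fun=> 0); last by apply/funext => w; rewrite big_nil.
  exact: (@cst_continuous 'rV[R]_n).
rewrite (_ : (fun _ => _) = (fun w : 'rV[R]_n => w 0 i * w 0 i) \+
    (fun w => \sum_(j <- s) w 0 j ^+ 2)); last first.
  by apply/funext => w; rewrite big_cons expr2.
apply: continuousD => //.
by apply: (@continuousM _ 'rV[R]_n); exact: coord_continuous.
Qed.

Lemma unit_disk_open : open (@unit_disk R).
Proof.
rewrite /unit_disk /eball; under eq_set do rewrite subr0.
apply: (@open_comp _ _ (@enorm R 2) [set x | x < 1]); last exact: open_lt.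
by move=> z _; exact: enorm_continuous.
Qed.

Lemma unit_disk_near (z : V2) : unit_disk z -> \forall w \near z, unit_disk w.
Proof. by move=> Dz; apply: open_nbhs_nbhs; split=> //; exact: unit_disk_open. Qed.

Lemma is_derive_coord (z v : V2) (j : 'I_2) : is_derive z v (fun w : V2 => w 0 j) (v 0 j).
Proof.
apply/is_derive_cvg; apply: (@cvg_trans _ ((fun=> v 0 j) @ (0 : R)^')); last exact: cvg_cst.
apply: near_eq_cvg; near=> t; have t0 : t != 0 by near: t; exact: nbhs_dnbhs_neq.
by rewrite !mxE addrK mulKf.
Unshelve. all: by end_near. Qed.

Lemma gdisk_derive (v : V2) f : gdisk f ->
  exists2 f', gdisk f' & forall z, unit_disk z -> is_derive z v f (f' z).
Proof.
move=> gf; have [f' gf' df] := @gcl_is_derive _ r h rho h0 rho0 h_rho _ xi up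
  (fun=> v 0 0) (fun=> v 0 1) v (fun z => is_derive_coord z v 0)
  (fun z => is_derive_coord z v 1) (gcl_cst _ _ _ _ _ _) (gcl_cst _ _ _ _ _ _) f gf.
by exists f' => // z /unit_disk_halfplane; exact: df.
Qed.

(** Induction on [k]. Agreement with the class is asked on the disk only, because the partial
    derivatives of [f] are identified only there. *)
Lemma gdisk_class_C k (f : V2 -> V3) :
  (forall j, exists2 g, gdisk g & forall z, unit_disk z -> f z 0 j = g z) ->
  class_C k (@unit_disk R) f.
Proof.
have cont (u : V2 -> V3) :
    (forall j, exists2 g, gdisk g & forall z, unit_disk z -> u z 0 j = g z) ->
    forall z, unit_disk z -> {for z, continuous u}.
  move=> {f}ug z Dz; apply: continuous_row => j; have [g gg uE] := ug j.
  have cg : {for z, continuous g}.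
    apply: gcl_continuous gg _ (unit_disk_halfplane Dz) => //; exact: coord_continuous.
  change (u w 0 j @[w --> z] --> u z 0 j).
  rewrite uE//; apply: cvg_trans cg; apply: near_eq_cvg; first exact: (@nbhs_filter V2 z).
  by apply: filterS (unit_disk_near Dz) => w Dw; rewrite uE.
elim: k f => [|k IH] f fg; first by split=> //; exact: cont.
split; first exact: cont.
move=> i; have dfg j : exists2 g', gdisk g' &
    forall z, unit_disk z -> is_derive z (delta_mx 0 i) (fun w => f w 0 j) (g' z).
  have [g gg fE] := fg j; have [g' gg' dg] := gdisk_derive (delta_mx 0 i) gg.
  exists g' => // z Dz; apply: near_eq_is_derive (dg z Dz).
  by apply: filterS (unit_disk_near Dz) => w Dw; rewrite fE.
split.
  move=> z Dz; apply/derivable_mxP => a j; rewrite (ord1 a).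
  by have [g' _ /(_ z Dz)[]] := dfg j.
apply: IH => j; have [g' gg' dg] := dfg j; exists g' => // z Dz.
have df : derivable f z (delta_mx 0 i).
  apply/derivable_mxP => a b; rewrite (ord1 a).
  by have [g1 _ /(_ z Dz)[]] := dfg b.
rewrite /partial derive_mx// mxE.
by rewrite (@derive_val _ _ _ _ _ _ _ (dg z Dz)).
Qed.

(** On the circle [r * cos t < 1] for every [t], so all iterated derivatives stay in the class. *)
Lemma derive1n_row m (F : R -> V3) :
  (forall j, exists2 g, gcl r h rho cos sin g & forall t, F t 0 j = g t) ->
  forall t, derivable (derive1n m F) t 1.
Proof.
have dg g : gcl r h rho cos sin g ->
    exists2 g', gcl r h rho cos sin g' & forall t : R, is_derive t 1 g (g' t).
  move=> gg.
  have dcos (t : R) : is_derive t 1 cos (-1 * sin t).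
    by rewrite mulN1r; exact: is_derive_cos.
  have [g' gg' dg] := @gcl_is_derive _ r h rho h0 rho0 h_rho R cos sin
    (fun t => -1 * sin t) cos 1 dcos (fun t => is_derive_sin t)
    (gcl_mul (gcl_cst _ _ _ _ _ _) (gcl_up _ _ _ _ _)) (gcl_xi _ _ _ _ _) g gg.
  exists g' => // t; apply: dg; apply: le_lt_trans r1.
  by rewrite ger_pMr// cos_le1.
elim: m F => [|m IH] F FG t.
  apply/derivable_mxP => i j; rewrite (ord1 i); have [g gg FE] := FG j.
  by rewrite (funext FE : (fun x => F x 0 j) = g); have [g' _ /(_ t)[]] := dg g gg.
rewrite derive1Sn; apply: IH => j; have [g gg FE] := FG j.
have [g' gg' dg'] := dg g gg; exists g' => // s.
have dF : derivable F s 1.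
  apply/derivable_mxP => a b; rewrite (ord1 a); have [g2 gg2 FE2] := FG b.
  by rewrite (funext FE2 : (fun x => F x 0 b) = g2); have [g3 _ /(_ s)[]] := dg g2 gg2.
rewrite derive1E derive_mx// mxE (funext FE : (fun x => F x 0 j) = g).
by rewrite (@derive_val _ _ _ _ _ _ _ (dg' s)).
Qed.

Lemma strip_row_smooth c : (forall i, good rho (c i)) ->
  smooth_on_circle (strip_row c).
Proof.
move=> gc m t; apply: derive1n_row => j.
exists (fun s => psum (c j) (logre r h (cos s) (sin s)) (logim r h (cos s) (sin s))).
  exact: gcl_psum.
by move=> s; rewrite !mxE.
Qed.

Let G (z : V2) := cauchy_re r h (z 0 0) (z 0 1).
Let H (z : V2) := cauchy_im r h (z 0 0) (z 0 1).
Let P c (z : V2) := psum c (logre r h (z 0 0) (z 0 1)) (logim r h (z 0 0) (z 0 1)).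

Lemma is_derive_strip c (z v : V2) : good rho c -> unit_disk z ->
  is_derive z v (P c) (P (coef_dx c) z * (G z * v 0 0 + H z * v 0 1) +
    P (coef_dy c) z * (G z * v 0 1 - H z * v 0 0)).
Proof.
move=> gc /unit_disk_halfplane rz.
apply: (is_derive_psum rho0 gc) => [w||].
- exact: logim_le.
- by apply: is_derive_logre => //; exact: is_derive_coord.
- by apply: is_derive_logim => //; exact: is_derive_coord.
Qed.

(** The Cauchy-Riemann equations for [G - i H], the derivative of the holomorphic change of
    variables. *)
Lemma cauchy_harmonic (z : V2) : unit_disk z ->
  exists dG dH : V2 -> R,
  [/\ forall v, is_derive z v G (dG v), forall v, is_derive z v H (dH v),
      dG (delta_mx 0 0) + dH (delta_mx 0 1) = 0 &
      dG (delta_mx 0 1) - dH (delta_mx 0 0) = 0].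
Proof.
move=> /unit_disk_halfplane rz; have Q0 := sqdist_gt0 (z 0 1) rz.
have n0 := lt0r_neq0 Q0.
have dQ v := is_derive_inv (f := fun w : V2 => sqdist r (w 0 0) (w 0 1)) n0
  (is_derive_sqdist r (is_derive_coord z v 0) (is_derive_coord z v 1)).
have d1 v : is_derive z v (fun w : V2 => h * r * (1 - r * w 0 0)) (- (h * r * r * v 0 0)).
  have K := is_derive_scale (h * r) (is_derive_add (is_derive_const 1 z v)
    (is_derive_scale (- r) (is_derive_coord z v 0))).
  have {}K := is_derive_coef K (_ : _ = - (h * r * r * v 0 0)).
  by move: K; under eq_fun do rewrite mulNr; apply; ring.
have d2 v : is_derive z v (fun w : V2 => - (h * r * (r * w 0 1))) (- (h * r * r * v 0 1)).
  have K := is_derive_scale (- (h * r * r)) (is_derive_coord z v 1).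
  by move: K; under eq_fun do rewrite mulNr -[h * r * r * _]mulrA; rewrite mulNr.
do 2 eexists; split=> [v|v||].
- exact: is_derive_mul (d1 v) (dQ v).
- exact: is_derive_mul (d2 v) (dQ v).
- by rewrite /= !mxE /= /sqdist; field; exact: n0.
- by rewrite /= !mxE /= /sqdist; field; exact: n0.
Qed.

(** Conformal invariance: the Laplacian and the cross product both acquire the Jacobian factor
    [G ^+ 2 + H ^+ 2]. *)
Lemma strip_row_solves c : (forall i, good rho (c i)) -> Hcoefs c ->
  solves_Hsystem (strip_row c) (strip_row c).
Proof.
move=> gc Hc; split=> //.
- apply: gdisk_class_C => j; exists (P (c j)); first exact: gcl_psum.
  by move=> z _; rewrite /strip_row mxE.
- apply: continuous_in_subspaceT => z /[!inE] /closed_disk_halfplane rz.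
  apply: continuous_row => j.
  have -> : (fun w => strip_row c w 0 j) = P (c j) by apply/funext => w; rewrite /strip_row mxE.
  apply: (gcl_continuous h0 rho0 h_rho (xi := xi) (up := up)) => //.
  - exact: coord_continuous.
  - exact: coord_continuous.
  - exact: gcl_psum.
  - exact: rz.
move=> z Dz.
pose dP (v : V2) j w := P (coef_dx (c j)) w * (G w * v 0 0 + H w * v 0 1) +
  P (coef_dy (c j)) w * (G w * v 0 1 - H w * v 0 0).
have dR i w : unit_disk w -> partial i (strip_row c) w = \row_j dP (delta_mx 0 i) j w.
  move=> Dw; apply: (is_derive_row _).2 => j.
  have -> : (fun w => strip_row c w 0 j) = P (c j) by apply/funext => y; rewrite /strip_row mxE.
  exact: is_derive_strip.
have [dG [dH [DG DH GH0 GH1]]] := cauchy_harmonic Dz.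
(* The factors [(i == 0)%:R] and [(i == 1)%:R] are the entries of [delta_mx 0 i], so one formula
   covers both second derivatives. *)
have ddR i : partial i (partial i (strip_row c)) z = \row_j
    (P (coef_dx (c j)) z * (dG (delta_mx 0 i) * (i == 0)%:R + dH (delta_mx 0 i) * (i == 1)%:R) +
     (P (coef_dx (coef_dx (c j))) z * (G z * (i == 0)%:R + H z * (i == 1)%:R) +
      P (coef_dy (coef_dx (c j))) z * (G z * (i == 1)%:R - H z * (i == 0)%:R)) *
     (G z * (i == 0)%:R + H z * (i == 1)%:R) +
     (P (coef_dy (c j)) z * (dG (delta_mx 0 i) * (i == 1)%:R - dH (delta_mx 0 i) * (i == 0)%:R) +
     (P (coef_dx (coef_dy (c j))) z * (G z * (i == 0)%:R + H z * (i == 1)%:R) +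
      P (coef_dy (coef_dy (c j))) z * (G z * (i == 1)%:R - H z * (i == 0)%:R)) *
     (G z * (i == 1)%:R - H z * (i == 0)%:R))).
  rewrite {1}/partial (near_eq_derive (g := fun w => \row_j dP (delta_mx 0 i) j w)); last first.
    by apply: filterS (unit_disk_near Dz) => w Dw; rewrite dR.
  apply: (is_derive_row _).2 => j.
  have -> : (fun w => (\row_j0 dP (delta_mx 0 i) j0 w) 0 j) = (fun w =>
     P (coef_dx (c j)) w * ((i == 0)%:R * G w + (i == 1)%:R * H w) +
     P (coef_dy (c j)) w * ((i == 1)%:R * G w + - (i == 0)%:R * H w)).
    apply/funext => w; rewrite /dP !mxE /= ![0 == i]eq_sym ![1 == i]eq_sym.
    by ring.
  have dA := is_derive_strip (delta_mx 0 i) (good_coef_dx rho0 (gc j)) Dz.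
  have dB := is_derive_strip (delta_mx 0 i) (good_coef_dy rho0 (gc j)) Dz.
  have lin a b : is_derive z (delta_mx 0 i) (fun w => a * G w + b * H w)
     (a * dG (delta_mx 0 i) + b * dH (delta_mx 0 i)).
    exact: is_derive_add (is_derive_scale a (DG _)) (is_derive_scale b (DH _)).
  apply: is_derive_coef (is_derive_add (is_derive_mul dA (lin _ _))
    (is_derive_mul dB (lin _ _))) _.
  rewrite !mxE /= ![0 == i]eq_sym ![1 == i]eq_sym.
  move: (P (coef_dx (c j)) z) (P (coef_dy (c j)) z) (P (coef_dx (coef_dx (c j))) z)
    (P (coef_dy (coef_dx (c j))) z) (P (coef_dx (coef_dy (c j))) z)
    (P (coef_dy (coef_dy (c j))) z) (G z) (H z) (dG _) (dH _)
    ((i == 0)%:R : R) ((i == 1)%:R : R) => *.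
  by clear; ring.
rewrite /laplacian big_ord_recl big_ord1 (_ : lift ord0 ord0 = 1); last exact: val_inj.
rewrite !ddR !dR//; apply/rowP => j; rewrite !mxE /dP !mxE /=.
have := psum_Hsystem rho0 gc Hc j (logre r h (z 0 0) (z 0 1)) (logim_le r h0 h_rho (z 0 0) (z 0 1)).
rewrite -/(P _ z) -/(P (coef_dy _) z).
rewrite -/(P (coef_dx (c (j + 1))) z) -/(P (coef_dx (c (j + 2%:R))) z).
rewrite -/(P (coef_dy (c (j + 1))) z) -/(P (coef_dy (c (j + 2%:R))) z) => E.
(* The Cauchy-Riemann equations remove the terms with first derivatives of the strip solution. *)
have -> : dG (delta_mx 0 0) = - dH (delta_mx 0 1) by apply/eqP; rewrite -addr_eq0 GH0.
have -> : dG (delta_mx 0 1) = dH (delta_mx 0 0) by apply/eqP; rewrite -subr_eq0 GH1.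
have {}E := congr1 (fun s => (G z ^+ 2 + H z ^+ 2) * s) E.
rewrite ?eqxx /=.
(* The mixed second derivatives cancel between the two directions. *)
transitivity ((G z ^+ 2 + H z ^+ 2) *
    (P (coef_dx (coef_dx (c j))) z + P (coef_dy (coef_dy (c j))) z)).
  move: (P (coef_dx (c j)) z) (P (coef_dy (c j)) z) (P (coef_dx (coef_dx (c j))) z)
    (P (coef_dy (coef_dx (c j))) z) (P (coef_dx (coef_dy (c j))) z)
    (P (coef_dy (coef_dy (c j))) z) (G z) (H z) (dH _) (dH _) => *.
  by clear; ring.
rewrite E; move: (P (coef_dx (c (j + 1))) z) (P (coef_dy (c (j + 1))) z)
  (P (coef_dx (c (j + 2%:R))) z) (P (coef_dy (c (j + 2%:R))) z) (G z) (H z) => *.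
by clear; ring.
Qed.

End DiskSolution.

(** * Circles on spheres, finite nets and the Hausdorff distance *)

Section SphereGeometry.
Context {R : realType}.
Local Notation V3 := 'rV[R]_3.
Implicit Types (a c q v : V3).

Definition dot n (v w : 'rV[R]_n) : R := \sum_i v 0 i * w 0 i.

Lemma enormE n (v : 'rV[R]_n) : enorm v = Num.sqrt (dot v v).
Proof. by congr Num.sqrt; apply: eq_bigr => i _; rewrite expr2. Qed.

Lemma dot_ge0 n (v : 'rV[R]_n) : 0 <= dot v v.
Proof. by apply: sumr_ge0 => i _; rewrite -expr2 sqr_ge0. Qed.

Lemma sphereP c v : esphere c 1 v <-> dot (v - c) (v - c) = 1.
Proof.
rewrite /esphere /= enormE; split=> [H|->]; last by rewrite sqrtr1.
by rewrite -[LHS]sqr_sqrtr ?dot_ge0// H expr1n.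
Qed.

(** A 3 by 2 matrix has a nonzero left kernel vector, which is rescaled to the length of [a]. *)
Lemma orthogonal_vector a c : exists q,
  [/\ dot q a = 0, dot q c = 0 & dot q q = dot a a].
Proof.
pose M := row_mx a^T c^T : 'M[R]_(3, 1 + 1).
have : kermx M != 0.
  rewrite kermx_eq0 /row_free; apply/negP => /eqP rM.
  by have := rank_leq_col M; rewrite rM.
case/rowV0Pn => v /sub_kermxP vM v0.
have vac i : (v *m M) 0 i = 0 by rewrite vM mxE.
have va : dot v a = 0.
  have := vac (lshift 1 0); rewrite mul_mx_row row_mxEl mxE => <-.
  by apply: eq_bigr => i _; rewrite mxE.
have vc : dot v c = 0.
  have := vac (rshift 1 0); rewrite mul_mx_row row_mxEr mxE => <-.
  by apply: eq_bigr => i _; rewrite mxE.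
have vv : 0 < dot v v.
  rewrite lt_neqAle dot_ge0 andbT eq_sym; apply: contra v0 => /eqP vv0.
  apply/eqP/rowP => i; rewrite mxE; apply/eqP.
  rewrite -[_ == 0]orbb -mulf_eq0; apply/eqP.
  by apply: (psumr_eq0P _ vv0) => // j _; rewrite -expr2 sqr_ge0.
have scale s w w' : dot (s *: w) w' = s * dot w w'.
  by rewrite /dot mulr_sumr; apply: eq_bigr => i _; rewrite mxE mulrA.
pose s := Num.sqrt (dot a a / dot v v).
exists (s *: v); split; rewrite ?scale ?va ?vc ?mulr0//.
have -> : dot v (s *: v) = s * dot v v.
  by rewrite -scale /dot; apply: eq_bigr => i _; rewrite mulrC.
by rewrite mulrA -expr2 sqr_sqrtr ?divfK ?gt_eqF// divr_ge0// ?dot_ge0// ltW.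
Qed.

(* The circle through [a] (at [t = 0]) and the origin (at infinity). *)
Definition circle_curve a q (t : R) : V3 :=
  (1 + t ^+ 2)^-1 *: a + (t * (1 + t ^+ 2)^-1) *: q.

(** As 0 and [a] lie on the sphere, [dot a a = 2 * dot a c]. With [q] orthogonal to [a] and [c] and
    of the length of [a], the squared distance from the curve to [c] is then constantly 1. *)
Lemma circle_on_sphere a c : esphere c 1 0 -> esphere c 1 a ->
  exists q, (forall i, `|q 0 i| <= 4) /\ forall t, esphere c 1 (circle_curve a q t).
Proof.
move=> c0 ca; have [q [qa qc qq]] := orthogonal_vector a c.
have c1 : dot c c = 1.
  by move/sphereP: c0 => <-; apply: eq_bigr => i _; rewrite !mxE sub0r mulrNN.
have aac : dot a a = 2 * dot a c.
  move/sphereP: ca; rewrite -[RHS]c1 /dot !big_ord_recl !big_ord0 !mxE => H.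
  by rewrite -[LHS]subr0 -(subrr (dot c c)) /dot !big_ord_recl !big_ord0 -[X in _ - (X - _)]H; ring.
exists q; split.
  move=> i.
  have cb j : `|c 0 j| <= 1.
    by have := enorm_coord c j; rewrite enormE c1 sqrtr1.
  have ab j : `|a 0 j| <= 2.
    have := enorm_coord (a - c) j; rewrite ca !mxE => h1.
    by have := ler_normD (a 0 j - c 0 j) (c 0 j); rewrite subrK; have := cb j; lra.
  have := enorm_coord q i; rewrite enormE qq => /le_trans; apply.
  rewrite -[leRHS]ger0_norm// -sqrtr_sqr ler_wsqrtr//.
  apply: (@le_trans _ _ (\sum_(j < 3) (4 : R))); last first.
    by rewrite sumr_const card_ord; lra.
  apply: ler_sum => j _; rewrite -expr2 -real_normK ?num_real//.
  by have := ab j; have := normr_ge0 (a 0 j); rewrite expr2; nra.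
move=> t; apply/sphereP.
set s := (1 + t ^+ 2)^-1.
have -> : dot (circle_curve a q t - c) (circle_curve a q t - c) =
    s ^+ 2 * (dot a a + 2 * t * dot q a + t ^+ 2 * dot q q)
    - 2 * s * (dot a c + t * dot q c) + dot c c.
  rewrite /dot !big_ord_recl !big_ord0 /circle_curve !mxE -/s; ring.
rewrite qa qc qq c1 aac !mulr0 !addr0 /s; field.
by rewrite gt_eqF// ltr_pwDl// sqr_ge0.
Qed.

Lemma enorm_le_coord v (e : R) : (forall i, `|v 0 i| <= e) -> enorm v <= 2 * e.
Proof.
move=> ve; have e0 : 0 <= e by exact: le_trans (ve 0).
rewrite -[leRHS]ger0_norm ?mulr_ge0// -sqrtr_sqr ler_wsqrtr//.
apply: (@le_trans _ _ (\sum_(j < 3) e ^+ 2)).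
  by apply: ler_sum => j _; rewrite -real_normK ?num_real// lerXn2r// nnegrE.
by rewrite sumr_const card_ord -mulr_natl !expr2; have := sqr_ge0 e; rewrite expr2; lra.
Qed.

(** Space is cut into cubes of side [e], and one point of [A] is kept for each cube that meets
    [A]. *)
Lemma finite_net (A : set V3) (b e : R) : A !=set0 -> 0 < e ->
  (forall x, A x -> forall i, `|x 0 i| <= b) ->
  exists (T : finType) (a : T -> V3), (forall t, A (a t)) /\
    forall x, A x -> exists t, forall i, `|x 0 i - a t 0 i| <= e.
Proof.
move=> [x0 Ax0] e0 Ab.
have y0 x i : A x -> 0 <= (x 0 i + b) / e.
  by move=> /Ab/(_ i); rewrite ler_norml => /andP[hx _]; apply: divr_ge0; [lra|exact: ltW].
pose M := Num.truncn (2 * b / e).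
pose code (x : V3) : {ffun 'I_3 -> 'I_M.+1} :=
  [ffun i => inord (Num.truncn ((x 0 i + b) / e))].
(* A cube that misses [A] receives the point [x0]. *)
have /choice[a Ha] : forall t, exists a, A a /\ ((exists2 x, A x & code x = t) -> code a = t).
  move=> t; have [[x Ax xt]|nt] := pselect (exists2 x, A x & code x = t).
    by exists x.
  by exists x0; split.
exists {ffun 'I_3 -> 'I_M.+1}, a; split=> [t|x Ax]; first by case: (Ha t).
exists (code x) => i.
have [Aa /(_ (ex_intro2 _ _ x Ax erefl)) ax] := Ha (code x).
have trM (z : V3) : A z -> (Num.truncn ((z 0 i + b) / e)%R < M.+1)%N.
  move=> Az; rewrite ltnS; apply: le_truncn.
  rewrite ler_pM2r ?invr_gt0//; have := Ab z Az i; rewrite ler_norml => /andP[]; lra.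
have := congr1 (fun f : {ffun 'I_3 -> 'I_M.+1} => nat_of_ord (f i)) ax.
rewrite !ffunE !inordK ?trM// => tE.
have /andP[x1 x2] := truncn_itv (y0 x i Ax).
have /andP[a1 a2] := truncn_itv (y0 _ i Aa).
rewrite tE in a1 a2.
rewrite -natr1 in x2 a2.
have : `|(x 0 i + b) / e - (a (code x) 0 i + b) / e| <= 1.
  by rewrite ler_norml; apply/andP; split; lra.
rewrite -mulrBl normrM [X in _ * X]gtr0_norm ?invr_gt0// ler_pdivrMr// mul1r.
by rewrite (_ : _ + b - _ = x 0 i - a (code x) 0 i)//; ring.
Qed.

Lemma hausdorff_dist_le (A B : set V3) (e : R) :
  (forall x, A x -> exists2 y, B y & enorm (x - y) <= e) ->
  (forall y, B y -> exists2 x, A x & enorm (y - x) <= e) ->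
  (hausdorff_dist A B <= e%:E)%E.
Proof.
move=> AB BA; rewrite /hausdorff_dist ge_max; apply/andP; split.
  apply: ge_ereal_sup => _ [x Ax <-]; have [y By xy] := AB x Ax.
  by apply: (@le_trans _ _ (enorm (x - y))%:E); [apply: ereal_inf_lbound; exists y|rewrite lee_fin].
apply: ge_ereal_sup => _ [x Ax <-]; have [y By xy] := BA x Ax.
by apply: (@le_trans _ _ (enorm (x - y))%:E); [apply: ereal_inf_lbound; exists y|rewrite lee_fin].
Qed.

Lemma hausdorff_dist_ge0 (A B : set V3) : A !=set0 -> (0 <= hausdorff_dist A B)%E.
Proof.
move=> [x Ax]; rewrite /hausdorff_dist le_max; apply/orP; left.
apply: (@le_trans _ _ (edist_to B x)); last by apply: ereal_sup_ubound; exists x.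
by apply: le_ereal_inf_tmp => _ [y By <-]; rewrite lee_fin sqrtr_ge0.
Qed.

End SphereGeometry.

(** * The curve that visits all circles, and the abscissas reached by the disk *)

Section MultiCircleCurve.
Context {R : realType}.
Local Notation V3 := 'rV[R]_3.

(* A curve that runs close to each of the circles in turn, the one of index [t]
   being traversed near the abscissa [rank * L]. *)
Definition multi_circle (T : finType) (a q : T -> V3) (L : R) (i : 'I_3) (x : R) : R :=
  \sum_t circle_curve (a t) (q t) (x - (enum_rank t)%:R * L) 0 i.

Lemma adm_multi_circle (T : finType) (a q : T -> V3) (L : R) :
  exists B, forall i, adm 1 B (multi_circle a q L i).
Proof.
exists (\sum_(t : T) \sum_i (`|a t 0 i| + `|q t 0 i|)) => i; apply: adm_sum => t.
apply: (adm_weaken (d := 1) (M := `|a t 0 i| * 1 + `|q t 0 i| * 1)) => //.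
  rewrite !mulr1 (bigD1 i)//= lerDl; apply: sumr_ge0 => j _; exact: addr_ge0.
apply: adm_ext (adm_add (adm_scale (a t 0 i) (adm_even ((enum_rank t)%:R * L)))
  (adm_scale (q t 0 i) (adm_odd ((enum_rank t)%:R * L)))) => x.
by rewrite /circle_curve !mxE mulrC; congr (_ + _); rewrite mulrC.
Qed.

Lemma circle_curve_far (a q : V3) i (d x : R) : 0 < d -> d <= `|x| ->
  `|a 0 i| <= 4 -> `|q 0 i| <= 4 -> `|circle_curve a q x 0 i| <= 8 / d.
Proof.
move=> d0 dx ai qi; rewrite /circle_curve !mxE.
have x0 : 0 < `|x| by exact: lt_le_trans dx.
have s0 : 0 < 1 + x ^+ 2 by rewrite ltr_pwDl// sqr_ge0.
have sx : `|x| <= 1 + x ^+ 2.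
  by rewrite -(real_normK (num_real x)); have := sqr_ge0 (`|x| - 1 / 2); rewrite !expr2; nra.
have p1 : (1 + x ^+ 2)^-1 <= d^-1 by rewrite lef_pV2 ?posrE// (le_trans dx).
have p2 : `|x| * (1 + x ^+ 2)^-1 <= d^-1.
  rewrite ler_pdivrMr// ler_pdivlMl//; apply: (@le_trans _ _ (`|x| * `|x|)).
    by rewrite ler_wpM2r.
  by rewrite -expr2 real_normK ?num_real// lerDr.
rewrite (le_trans (ler_normD _ _))// !normrM [`|_^-1|]gtr0_norm ?invr_gt0//.
rewrite (_ : 8 / d = d^-1 * 4 + d^-1 * 4); last by field; rewrite gt_eqF.
by rewrite lerD// ler_pM// ?mulr_ge0// invr_ge0 ltW.
Qed.

(** Each of the other circles contributes at most [8 / (L / 2)] by [circle_curve_far]. *)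
Lemma multi_circle_near (T : finType) (a q : T -> V3) (L : R) t (x : R) i :
  0 < L -> (forall t i, `|a t 0 i| <= 4) -> (forall t i, `|q t 0 i| <= 4) ->
  (forall t', t' != t -> L / 2 <= `|x - (enum_rank t')%:R * L|) ->
  `|multi_circle a q L i x - circle_curve (a t) (q t) (x - (enum_rank t)%:R * L) 0 i|
    <= #|T|%:R * (16 / L).
Proof.
move=> L0 a4 q4 far; rewrite /multi_circle (bigD1 t)//= addrAC subrr add0r.
rewrite (le_trans (ler_norm_sum _ _ _))//.
apply: (@le_trans _ _ (\sum_(t' | t' != t) (16 / L))).
  apply: ler_sum => t' tt'.
  have -> : 16 / L = 8 / (L / 2) by field; rewrite gt_eqF.
  by apply: circle_curve_far => //; [rewrite divr_gt0|exact: far].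
have l0 : 0 <= 16 / L by rewrite divr_ge0// ltW.
by rewrite sumr_const -[_ *+ #|_|]mulr_natl ler_wpM2r// ler_nat; exact: max_card.
Qed.

Lemma rank_dist (T : finType) (L : R) (t t' : T) : 0 < L -> t' != t ->
  L <= `|(enum_rank t)%:R * L - (enum_rank t')%:R * L|.
Proof.
move=> L0 tt'; rewrite -mulrBl normrM (gtr0_norm L0) ler_peMl ?(ltW L0)//.
have nn : enum_rank t' != enum_rank t :> nat.
  by apply: contra tt' => /eqP/val_inj/enum_rank_inj ->.
have [lt|lt|e] := ltngtP (enum_rank t') (enum_rank t); last by rewrite e eqxx in nn.
  by rewrite -natrB ?(ltnW lt)// normr_nat ler1n subn_gt0.
by rewrite distrC -natrB ?(ltnW lt)// normr_nat ler1n subn_gt0.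
Qed.

(** Enlarging [rho] narrows the strip while keeping the series. *)
Lemma good_widen (rho rho' : R) c : rho <= rho' -> good rho c -> good rho' c.
Proof. by move=> rr [d gd]; exists d => s rs; apply: gd; exact: le_lt_trans rs. Qed.

(** Solving [- h * ln (1 - r * p) = s] gives a real [p], and the last hypothesis says that
    [p < 1]. *)
Lemma real_axis_reached (r h s : R) : 0 < r -> 0 < h -> 0 <= s ->
  1 - expR (- (s / h)) < r ->
  exists z : 'rV[R]_2, [/\ unit_disk z,
    logre r h (z 0 0) (z 0 1) = s & logim r h (z 0 0) (z 0 1) = 0].
Proof.
move=> r0 h0 s0 sr; set p := (1 - expR (- (s / h))) / r.
have p0 : 0 <= p.
  rewrite divr_ge0 ?(ltW r0)// subr_ge0 -[leRHS]expR0 ler_expR oppr_le0.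
  by rewrite divr_ge0// ltW.
exists (\row_i (if i == 0 then p else 0)); rewrite !mxE /=; split.
- rewrite /unit_disk /eball /= subr0 /enorm !big_ord_recl big_ord0 !mxE /=.
  by rewrite expr0n /= !addr0 sqrtr_sqr ger0_norm// ltr_pdivrMr// mul1r.
- rewrite /logre /sqdist mulr0 expr0n /= addr0 /p mulrCA divff ?gt_eqF// mulr1.
  by rewrite subKr lnXn ?expR_gt0// expRK -mulr_natl; field; rewrite gt_eqF.
- by rewrite /logim mulr0 mul0r atan0 mulr0.
Qed.

End MultiCircleCurve.

(** * Choice of the parameters and the error estimate *)

Section Approximation.
Context {R : realType}.

(** At most three errors [e] occur in each coordinate: from [A] to the net, from the net or circle
    to the curve, from the curve to the solution. Passing to the Euclidean norm doubles their
    sum. *)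
Lemma Hsystem_approx (k : nat) (S : 'I_k -> set 'rV[R]_3) (e : R) :
  (0 < k)%N -> (forall i, exists c : 'rV[R]_3, S i = esphere c 1) ->
  (forall i, S i 0) -> 0 < e ->
  exists u : 'rV[R]_2 -> 'rV[R]_3, [/\ smooth_on_circle u, solves_Hsystem u u &
    (hausdorff_dist (u @` @unit_disk R) (\bigcup_(i : 'I_k) S i) <= (6 * e)%:E)%E].
Proof.
move=> k0 Ssph S0 e0; set A := \bigcup_(i : 'I_k) S i.
have A0 : A !=set0 by exists 0, (Ordinal k0).
have Ab x : A x -> forall i, `|x 0 i| <= 4.
  move=> [j _ Sx] i; have [c Sc] := Ssph j; move: Sx (S0 j); rewrite Sc => xc zc.
  have := enorm_coord (x - c) i; rewrite xc !mxE => h1.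
  have := enorm_coord (0 - c) i; rewrite zc !mxE sub0r normrN => h2.
  by have := ler_normD (x 0 i - c 0 i) (c 0 i); rewrite subrK; lra.
have [T [a [Aa net]]] := finite_net A0 e0 Ab.
have /choice[q Hq] : forall t, exists q : 'rV[R]_3,
    (forall i, `|q 0 i| <= 4) /\ forall s, A (circle_curve (a t) q s).
  move=> t; have [j _ Sa] := Aa t; have [c Sc] := Ssph j; move: Sa (S0 j).
  rewrite Sc => ac zc; have [q [q4 qc]] := circle_on_sphere zc ac.
  by exists q; split=> // s; exists j => //; rewrite Sc.
have [t0] : exists t : T, True by have [x /net[t _]] := A0; exists t.
have T0 : (0 < #|T|)%N by apply/card_gt0P; exists t0.
have T0R : (0 : R) < #|T|%:R by rewrite ltr0n.
(* The spacing for which [#|T|] contributions of [16 / L] add up to [e]. *)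
pose L := #|T|%:R * 16 / e.
have L0 : 0 < L by rewrite divr_gt0// mulr_gt0.
have LE : #|T|%:R * (16 / L) = e.
  by rewrite /L; field; rewrite !gt_eqF.
have [B gB] := adm_multi_circle a q L.
have [rho [c [rho0 c0 gc Hc]]] := Hcoefs_exist gB.
have /choice[C HC] := fun i => psum_lipschitz rho0 (gc i).
pose D := 1 + \sum_i `|C i|.
have CD i : `|C i| <= D.
  by rewrite /D (bigD1 i)//= addrCA lerDl addr_ge0// sumr_ge0.
have D0 : 0 < D by rewrite ltr_pwDl// sumr_ge0.
(* The strip is narrowed until a function with Lipschitz constant [D] varies by at most [e] between
   the axis and any point above or below it. *)
pose rho' := rho + D / (4 * e).
have rr : rho <= rho' by rewrite lerDl divr_ge0// ?mulr_ge0// ltW.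
have rho'0 : 0 < rho' by exact: lt_le_trans rr.
have De : D * (4 * rho')^-1 <= e.
  rewrite ler_pdivrMr ?mulr_gt0// /rho' mulrDr mulrDr.
  have -> : e * (4 * (D / (4 * e))) = D by field; rewrite gt_eqF.
  by rewrite lerDr !mulr_ge0// ltW.
pose h := (4 * rho')^-1 / (pi / 2).
have pi0 : 0 < pi / 2 :> R by rewrite divr_gt0// pi_gt0.
have h0 : 0 < h by rewrite divr_gt0// invr_gt0 mulr_gt0.
have h_rho : h * (pi / 2) <= (4 * rho')^-1 by rewrite divfK ?gt_eqF.
(* The real points of the disk then reach all abscissas from 0 up to [#|T|%:R * L], and every centre
   lies below this since ranks are smaller than [#|T|]. *)
pose r := 1 - expR (- ((#|T|%:R * L) / h)).
have r0 : 0 < r.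
  rewrite subr_gt0 -[ltRHS]expR0 ltr_expR oppr_lt0 divr_gt0// mulr_gt0//.
have r1 : r < 1 by rewrite ltrBlDr ltrDl expR_gt0.
have gc' i := good_widen rr (gc i).
exists (strip_row r h c); split.
- exact: (strip_row_smooth r0 r1 h0 rho'0 h_rho gc').
- exact: (strip_row_solves r0 r1 h0 rho'0 h_rho gc' Hc).
have close z i : `|strip_row r h c z 0 i - multi_circle a q L i (logre r h (z 0 0) (z 0 1))| <= e.
  rewrite mxE -(c0 i) -psum_axis.
  set x := logre _ _ _ _; set y := logim _ _ _ _.
  have yl : `|y| <= (4 * rho')^-1 by exact: logim_le.
  have yr : `|y| <= (4 * rho)^-1.
    by apply: le_trans yl _; rewrite lef_pV2 ?posrE ?mulr_gt0// ler_pM2l.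
  have z0 : `|0 : R| <= (4 * rho)^-1 by rewrite normr0 invr_ge0 mulr_ge0// ltW.
  apply: le_trans (HC i x x 0 y z0 yr) _; rewrite subrr normr0 add0r subr0.
  apply: le_trans De; apply: (@le_trans _ _ (D * `|y|)).
    by rewrite ler_wpM2r// (le_trans (ler_norm _)).
  by rewrite ler_wpM2l// ltW.
have a4 t i : `|a t 0 i| <= 4 by exact: Ab.
have q4 t i : `|q t 0 i| <= 4 by case: (Hq t).
have visit (t : T) x i : `|x - (enum_rank t)%:R * L| < L / 2 ->
    `|multi_circle a q L i x - circle_curve (a t) (q t) (x - (enum_rank t)%:R * L) 0 i| <= e.
  move=> xt; rewrite -LE; apply: multi_circle_near => // t' tt'.
  have := rank_dist L0 tt'.
  have := ler_normB (x - (enum_rank t')%:R * L) (x - (enum_rank t)%:R * L).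
  rewrite (_ : _ - _ - (_ - _) = (enum_rank t)%:R * L - (enum_rank t')%:R * L); last by ring.
  lra.
rewrite (_ : 6 * e = 2 * (e + e + e)); last by ring.
apply: hausdorff_dist_le.
- move=> _ [z Dz <-]; set x := logre r h (z 0 0) (z 0 1).
  have [t Ht] : exists t, forall i, `|multi_circle a q L i x -
      circle_curve (a t) (q t) (x - (enum_rank t)%:R * L) 0 i| <= e.
    have [[t xt]|far] := pselect (exists t : T, `|x - (enum_rank t)%:R * L| < L / 2).
      by exists t => i; exact: visit.
    (* Far from all centres any index will do, since every circle is then close to the origin. *)
    exists t0 => i; rewrite -LE; apply: multi_circle_near => // t' _.
    by rewrite leNgt; apply/negP => xt; apply: far; exists t'.
  exists (circle_curve (a t) (q t) (x - (enum_rank t)%:R * L)); first by case: (Hq t).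
  apply: enorm_le_coord => i; rewrite mxE [X in _ + X]mxE.
  have := ler_normD (strip_row r h c z 0 i - multi_circle a q L i x) (multi_circle a q L i x -
      circle_curve (a t) (q t) (x - (enum_rank t)%:R * L) 0 i).
  rewrite subrKA => /le_trans; apply; rewrite -[leLHS]addr0 lerD ?(ltW e0)//.
  by rewrite lerD.
move=> x Ax; have [t xt] := net x Ax.
set s := (enum_rank t)%:R * L.
have s0 : 0 <= s by rewrite mulr_ge0// ltW.
have [|z [Dz zs _]] := @real_axis_reached R r h s r0 h0 s0.
  rewrite /r ltrD2l ltrN2 ltr_expR ltrN2 ltr_pM2r ?invr_gt0// ltr_pM2r//.
  by rewrite ltr_nat.
exists (strip_row r h c z); first by exists z.
(* At the abscissa [s] the circle of index [t] is at parameter 0, that is, at [a t]. *)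
have near0 i : `|multi_circle a q L i s - a t 0 i| <= e.
  have := @visit t s i; rewrite subrr normr0 divr_gt0// => /(_ isT).
  by rewrite /circle_curve !mxE expr0n /= addr0 invr1 !mul1r !mul0r addr0.
apply: enorm_le_coord => i; rewrite mxE [X in _ + X]mxE.
have := close z i; rewrite zs distrC => h3.
rewrite (_ : x 0 i - _ = (x 0 i - a t 0 i) + (a t 0 i - multi_circle a q L i s) +
  (multi_circle a q L i s - strip_row r h c z 0 i)); last by ring.
rewrite (le_trans (ler_normD _ _))// lerD// (le_trans (ler_normD _ _))// lerD//.
by rewrite distrC.
Qed.

End Approximation.

Theorem theorem1p2 (R : realType) (k : nat) (k_gt0 : (0 < k)%N)
    (S : 'I_k -> set 'rV[R]_3)
    (S_unit_sphere : forall i, exists c : 'rV[R]_3, S i = esphere c 1)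
    (S_origin : forall i, S i 0) :
  exists (g u : nat -> 'rV[R]_2 -> 'rV[R]_3),
    [/\ forall n, smooth_on_circle (g n),
        forall n, solves_Hsystem (g n) (u n) &
        hausdorff_dist (u n @` @unit_disk R) (\bigcup_(i : 'I_k) S i)
          @[n --> \oo] --> 0%E].
Proof.
(* This choice turns the bound [6 * e] into [n.+1%:R^-1]. *)
have e0 n : (0 : R) < n.+1%:R^-1 / 6 by rewrite divr_gt0// invr_gt0.
have /choice[u Hu] := fun n => Hsystem_approx k_gt0 S_unit_sphere S_origin (e0 n).
(* Each solution supplies its own boundary data. *)
exists u, u; split=> [n|n|]; try by case: (Hu n).
apply: (@squeeze_cvge _ _ _ _ (fun=> 0%E) _ (fun n => (n.+1%:R^-1)%:E)).
- apply: nearW => n; case: (Hu n) => _ _; rewrite mulrC divfK// => ->.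
  rewrite andbT; apply: hausdorff_dist_ge0; exists (u n 0), 0 => //.
  rewrite /unit_disk /eball /= subrr /enorm big1 ?sqrtr0// => i _.
  by rewrite mxE expr0n.
- exact: cvg_cst.
- by apply: cvg_EFin; [exact: nearW|exact: cvg_harmonic].
Qed.
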